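(* Let $\mathcal O$ be a Syzygy algebra. For every ideal $\mathcal I\subset\mathcal O$, one can construct an arborescent Koszul-Tate resolution of $\mathcal O/\mathcal I$ by solving a finite number of $\mathcal O$-linear problems (of the first or second type) where all free $\mathcal O$-modules involved have finite rank.
   Context: $\mathbb K$ is the base field, $\mathcal O$ a commutative $\mathbb K$-algebra, ideals are proper. $\otimes,\odot$ are over $\mathcal O$. A Syzygy algebra is a Noetherian algebra $\mathcal O$ such that every finitely generated $\mathcal O$-module has a finite length resolution by finitely generated free $\mathcal O$-modules. $\mathcal O$-linear problem of the first type: given free or projective $\mathcal O$-modules $\mathcal N_1,\mathcal N_2$ and an $\mathcal O$-linear map $d_1:\mathcal N_1\to\mathcal N_2$, find a free or projective $\mathcal O$-module $\mathcal N_0$ and an $\mathcal O$-linear map $d_0:\mathcal N_0\to\mathcal N_1$ with $\mathrm{im}(d_0)=\ker(d_1)$. Second type: given $\mathcal O$-modules $\mathcal N_0,\mathcal N_1,\mathcal N_2$ with $\mathcal N_0$ free or projective, and $\mathcal O$-linear maps $\chi_1:\mathcal N_0\to\mathcal N_2$, $\chi_2:\mathcal N_1\to\mathcal N_2$ with $\chi_2$ surjective, construct an $\mathcal O$-linear map $\mathcal N_0\to\mathcal N_1$ whose composition with $\chi_2$ is $\chi_1$. A free $\mathcal O$-module resolution of $\mathcal O/\mathcal I$ is a complex $\cdots\to\mathfrak M_k\xrightarrow{d}\cdots\to\mathfrak M_1\xrightarrow{d}\mathcal O$ with $\mathcal O$ in degree $0$, $\mathfrak M_k$ in degree $k\ge1$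 free, $d$ $\mathcal O$-linear, no homology in positive degrees, and $d(\mathfrak M_1)=\mathcal I$. $S(\mathcal E)$ is the graded symmetric $\mathcal O$-algebra. Trees: planar rooted trees (ordered leaves) in which every vertex (the root and inner vertices; leaves are not vertices) has at least two children, plus the trivial tree $|$ with one leaf and $0$ vertices. $Tree^n$: $\mathbb K$-vector space on trees with $n$ leaves. $Tree[\mathfrak M_\bullet]=\bigoplus_{n\ge1}Tree^n\otimes_{\mathbb K}\mathfrak M_\bullet^{\otimes n}$, elements written $t[a_1,\dots,a_n]$, of degree $\#\{\text{vertices of }t\}+\sum|a_i|$. $\mathcal Tree[\mathfrak M_\bullet]$ is its quotient by $t[a]\sim\epsilon\,(\sigma\cdot t[a])$, where $\sigma$ permutes the children (decorated subtrees) of a vertex and $\epsilon$ is the Koszul sign for their degrees. $\mathcal Tree^{\ge2}[\mathfrak M_\bullet]$: the part spanned by trees with at least two leaves. Root map $\mathfrak r:S^{\ge2}(\mathcal Tree[\mathfrak M_\bullet])\to\mathcal Tree^{\ge2}[\mathfrak M_\bullet]$: the degree $+1$ isomorphism joining the roots of $T_1,\dots,T_k$ to a new root. Arborescent operation: $\mathcal O$-linear $\psi:\mathcal Tree^{\ge2}[\mathfrak M_\bullet]\to\mathfrak M_\bullet$ of degree $-1$. $\delta_\psi$ is the $\mathcal O$-linear degree $-1$ derivation of $S(\mathcal Tree[\mathfrak M_\bullet])$ with $\delta_\psi(|[a])=da\in\mathcal O$ if $|a|=1$, $=|[da]$ if $|a|\ge2$, and recursively on the degree $\delta_\psi(T)=-|[\psi(T)]-\mathfrak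 r(p^{\ge2}(\delta_\psi(\mathfrak r^{-1}T)))+\mathfrak r^{-1}(T)$ for $T\in\mathcal Tree^{\ge2}[\mathfrak M_\bullet]$, $p^{\ge2}$ being the projection onto $S^{\ge2}(\mathcal Tree[\mathfrak M_\bullet])$. An arborescent Koszul-Tate resolution of $\mathcal O/\mathcal I$ is $(S(\mathcal Tree[\mathfrak M_\bullet]),\delta_\psi)$ for a module resolution $(\mathfrak M_\bullet,d)$ and $\psi$ with $\delta_\psi^2=0$; constructing it means determining $(\mathfrak M_\bullet,d)$ and $\psi$. *)

(* Defs.v *)
From HB Require Import structures.
From mathcomp Require Import all_boot all_algebra.
From mathcomp Require Import boolp finmap.
From mathcomp Require Import monalg.

Set Implicit Arguments.
Unset Strict Implicit.
Unset Printing Implicit Defensive.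

Import GRing.Theory.
Local Open Scope ring_scope.

Section Span.
Variables (R : nzRingType) (V : lmodType R) (P : V -> Prop).

Inductive in_span : V -> Prop :=
| InSpan0 : in_span 0
| InSpanS (c : R) (x y : V) : P x -> in_span y -> in_span (c *: x + y).

Definition span : {pred V} := fun v => `[< in_span v >].

Lemma span_submod_closed : submod_closed span.
Proof.
split=> [|a u v /asboolP su /asboolP sv]; first exact/asboolP/InSpan0.
apply/asboolP; elim: su => [|c x y Px _ IH]; first by rewrite scaler0 add0r.
by rewrite scalerDr scalerA -addrA; apply: InSpanS.
Qed.

HB.instance Definition _ :=
  GRing.isSubmodClosed.Build R V span span_submod_closed.

(* The submodule of V generated by P, as a module in its own right. *)
Record spanned : Type := Spanned { spanned_val : V; _ : spanned_val \in span }.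

HB.instance Definition _ := [isSub for spanned_val].
HB.instance Definition _ := [Choice of spanned by <:].
HB.instance Definition _ := [SubChoice_isSubLmodule of spanned by <:].

(* The quotient of V by the submodule generated by P. *)
Definition quotmod : Type := Quotient.quot span.

HB.instance Definition _ := GRing.Zmodule.on quotmod.

Definition quot_class (v : V) : quotmod := \pi_(Quotient.quot span)%qT v.
Definition quot_repr (q : quotmod) : V :=
  generic_quotient.repr (q : Quotient.quot span).

Lemma quot_reprK q : quot_class (quot_repr q) = q.
Proof. exact: generic_quotient.reprK. Qed.

Lemma quot_classD u v : quot_class (u + v) = quot_class u + quot_class v.
Proof. exact: (raddfD (\pi_(Quotient.quot span)%qT)). Qed.

Lemma quot_classP u v : quot_class u = quot_class v <-> u - v \in span.
Proof. by rewrite Quotient.idealrBE; split=> [/eqP|/eqP]. Qed.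

Definition quot_scale (a : R) (q : quotmod) : quotmod :=
  quot_class (a *: quot_repr q).

Lemma quot_classZ a v : quot_class (a *: v) = quot_scale a (quot_class v).
Proof.
by apply/quot_classP; rewrite -scalerBr rpredZ //; apply/quot_classP;
   rewrite quot_reprK.
Qed.

Fact quot_scaleA a b q : quot_scale a (quot_scale b q) = quot_scale (a * b) q.
Proof. by rewrite -[q]quot_reprK -!quot_classZ scalerA. Qed.
Fact quot_scale1 : left_id 1 quot_scale.
Proof. by move=> q; rewrite -[q]quot_reprK -!quot_classZ scale1r. Qed.
Fact quot_scaleDr : right_distributive quot_scale +%R.
Proof.
move=> a p q; rewrite -[p]quot_reprK -[q]quot_reprK.
by rewrite -quot_classD -!quot_classZ scalerDr quot_classD.
Qed.
Fact quot_scaleDl q : {morph quot_scale^~ q : a b / a + b}.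
Proof.
move=> a b; rewrite -[q]quot_reprK.
by rewrite -!quot_classZ scalerDl quot_classD.
Qed.

HB.instance Definition _ := GRing.Zmodule_isLmodule.Build R quotmod
  quot_scaleA quot_scale1 quot_scaleDr quot_scaleDl.

End Span.

Section Modules.
Variable R : nzRingType.
Implicit Types A B C V : lmodType R.

Definition exact_at A B C (f : A -> B) (g : B -> C) : Prop :=
  forall b, g b = 0 <-> exists a, f a = b.

Definition trivial_module V : Prop := forall v : V, v = 0.

Definition free_module V : Prop :=
  exists (X : choiceType) (f : {linear {malg R[X]} -> V}), bijective f.

Definition free_of_finite_rank V : Prop :=
  exists (n : nat) (f : {linear 'rV[R]_n -> V}), bijective f.

Definition projective_module V : Prop :=
  forall A B (g : {linear A -> B}) (f : {linear V -> B}),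
    (forall b, exists a, g a = b) ->
    exists h : {linear V -> A}, forall v, g (h v) = f v.

Definition free_or_projective V : Prop := free_module V \/ projective_module V.

Definition finitely_generated V : Prop :=
  exists (n : nat) (f : {linear 'rV[R]_n -> V}), forall v, exists c, f c = v.

Definition has_finite_free_resolution V : Prop :=
  exists (F : nat -> lmodType R) (e : {linear F 0%N -> V})
         (d : forall k, {linear F k.+1 -> F k}),
    [/\ forall v, exists x, e x = v,
        exact_at (d 0%N) e,
        forall k, exact_at (d k.+1) (d k),
        forall k, free_of_finite_rank (F k)
      & exists n, forall k, (n <= k)%N -> trivial_module (F k)].

End Modules.

(* [idealr] is the type of proper ideals; the unit ideal is generated by 1. *)
Definition noetherian (O : comNzRingType) : Prop :=
  forall I : idealr O, exists (n : nat) (f : 'I_n -> O),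
    forall x, x \in I <-> exists c : 'I_n -> O, x = \sum_i c i * f i.

Definition syzygy_algebra (O : comNzRingType) : Prop :=
  noetherian O /\
  forall V : lmodType O, finitely_generated V -> has_finite_free_resolution V.

Section LinearProblems.
Variable O : comNzRingType.

Record first_type_problem (N1 N2 : lmodType O) := FirstTypeProblem {
  first_map : {linear N1 -> N2};
  first_source : free_or_projective N1;
  first_target : free_or_projective N2
}.

Definition solves_first_type (N1 N2 : lmodType O)
    (P : first_type_problem N1 N2) (N0 : lmodType O) (d0 : {linear N0 -> N1}) :=
  free_or_projective N0 /\ exact_at d0 (first_map P).

Record second_type_problem (N0 N1 : lmodType O) := SecondTypeProblem {
  second_target : lmodType O;
  chi1 : {linear N0 -> second_target};
  chi2 : {linear N1 -> second_target};
  second_source : free_or_projective N0;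
  chi2_surjective : forall y, exists x, chi2 x = y
}.

Definition solves_second_type (N0 N1 : lmodType O)
    (P : second_type_problem N0 N1) (f : {linear N0 -> N1}) :=
  forall x, chi2 P (f x) = chi1 P x.

End LinearProblems.

(* A free resolution of O/I; [resmod k] is the module in degree k.+1, and O
   itself sits in degree 0. *)
Record module_resolution (O : comNzRingType) (I : idealr O) :=
  ModuleResolution {
  resmod : nat -> lmodType O;
  aug : {linear resmod 0%N -> O^o};
  diff : forall k, {linear resmod k.+1 -> resmod k};
  resmod_free : forall k, free_module (resmod k);
  aug_image : forall x, x \in I <-> exists a, aug a = x;
  exact_aug : exact_at (diff 0%N) aug;
  exact_diff : forall k, exact_at (diff k.+1) (diff k)
}.

(* S(Tree[M]) is presented by generators and relations: as an O-module it is
   generated by planar forests whose leaves carry homogeneous elements of M.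
   Since Tree^n is the vector space on planar trees with n leaves,
   Tree^n (x) M^(x n) is the direct sum of one copy of M^(x n) per tree, so the
   base field does not enter. *)
Section Trees.
Variables (O : comNzRingType) (M : nat -> lmodType O).

(* A leaf carries an element of degree k.+1; a vertex has an ordered list of at
   least two children. *)
Inductive dtree : Type :=
| Leaf (k : nat) (a : M k)
| Node (t1 t2 : dtree) (ts : seq dtree).

HB.instance Definition _ := gen_eqMixin dtree.
HB.instance Definition _ := gen_choiceMixin dtree.

Definition forest : Type := seq dtree.

HB.instance Definition _ := Choice.on forest.

Fixpoint tdeg (t : dtree) : nat :=
  match t with
  | Leaf k _ => k.+1
  | Node t1 t2 ts => (tdeg t1 + tdeg t2 + sumn (map tdeg ts)).+1
  end.

Definition fdeg (F : forest) : nat := sumn (map tdeg F).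

(* F, G and H coincide except for the label of one leaf, which is a in F, b in G
   and c *: a + b in H. *)
Inductive lin_tree (c : O) : dtree -> dtree -> dtree -> Prop :=
| LinLeaf k (a b : M k) : lin_tree c (Leaf a) (Leaf b) (Leaf (c *: a + b))
| LinNode t1 t2 ts u1 u2 us v1 v2 vs :
    lin_forest c [:: t1, t2 & ts] [:: u1, u2 & us] [:: v1, v2 & vs] ->
    lin_tree c (Node t1 t2 ts) (Node u1 u2 us) (Node v1 v2 vs)
with lin_forest (c : O) : forest -> forest -> forest -> Prop :=
| LinHead t u v F :
    lin_tree c t u v -> lin_forest c (t :: F) (u :: F) (v :: F)
| LinTail t F G H :
    lin_forest c F G H -> lin_forest c (t :: F) (t :: G) (t :: H).

(* G is obtained from F by exchanging two neighbouring trees of the forest, or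
   two neighbouring children of a vertex, of degrees p and q; the Koszul sign is
   (-1) ^+ n with n = p * q. Such exchanges generate all the permutations. *)
Inductive swap : nat -> forest -> forest -> Prop :=
| SwapHead t u F : swap (tdeg t * tdeg u)%N [:: t, u & F] [:: u, t & F]
| SwapTail n t F G : swap n F G -> swap n (t :: F) (t :: G)
| SwapNode n t1 t2 ts u1 u2 us F :
    swap n [:: t1, t2 & ts] [:: u1, u2 & us] ->
    swap n (Node t1 t2 ts :: F) (Node u1 u2 us :: F).

Inductive forest_relation : {malg O[forest]} -> Prop :=
| MultilinearRel c F G H : lin_forest c F G H ->
    forest_relation (c *: << F >> + << G >> - << H >>)
| SymmetryRel n F G : swap n F G ->
    forest_relation (<< F >> - (-1) ^+ n *: << G >>).

Definition STree : Type := quotmod forest_relation.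

HB.instance Definition _ := GRing.Lmodule.on STree.

Definition fclass (F : forest) : STree := quot_class forest_relation << F >>.

(* The linear extension of f, evaluated on a representative of x; it does not
   depend on the representative for the functions f below. *)
Definition forest_ext (f : forest -> STree) (x : STree) : STree :=
  \sum_(F <- msupp (quot_repr x)) (quot_repr x)@_F *: f F.

Definition mulS (x y : STree) : STree :=
  forest_ext (fun F => forest_ext (fun G => fclass (F ++ G)) y) x.

Definition oneS : STree := fclass [::].

Definition leafS (k : nat) (a : M k) : STree := fclass [:: Leaf a].

Definition proj_ge2 : STree -> STree :=
  forest_ext (fun F => if (2 <= size F)%N then fclass F else 0).

Definition root_map : STree -> STree :=
  forest_ext (fun F =>
    if F is [:: t1, t2 & ts] then fclass [:: Node t1 t2 ts] else 0).

Definition root_inv : STree -> STree :=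
  forest_ext (fun F =>
    if F is [:: Node t1 t2 ts] then fclass [:: t1, t2 & ts] else 0).

(* The degree n component of Tree^{>=2}[M], inside Tree[M] = S^1(Tree[M]). *)
Definition is_tree_ge2 (n : nat) (x : STree) : Prop :=
  exists t1 t2 ts,
    tdeg (Node t1 t2 ts) = n /\ x = fclass [:: Node t1 t2 ts].

Definition tree_ge2 (n : nat) : Type := spanned (is_tree_ge2 n).

HB.instance Definition _ n := GRing.Lmodule.on (tree_ge2 n).

(* Trees with at least two leaves have degree at least 3, so these components
   exhaust the degree -1 maps to M. *)
Definition arborescent_operation : Type :=
  forall k, {linear tree_ge2 k.+2 -> M k}.

End Trees.

Section KoszulTate.
Variables (O : comNzRingType) (I : idealr O) (X : module_resolution I).
Local Notation M := (resmod X).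
Implicit Types (psi : arborescent_operation M) (delta : STree M -> STree M).

Record is_delta psi (delta : {linear STree M -> STree M}) : Prop := IsDelta {
  delta_leaf1 : forall a : M 0%N, delta (leafS a) = (aug X a : O) *: oneS M;
  delta_leaf : forall k (a : M k.+1), delta (leafS a) = leafS (diff X k a);
  delta_tree : forall k (T : tree_ge2 M k.+2),
    delta (spanned_val T) =
      - leafS (psi k T)
      - root_map (proj_ge2 (delta (root_inv (spanned_val T))))
      + root_inv (spanned_val T);
  delta_leibniz : forall F G : forest M,
    delta (mulS (fclass F) (fclass G)) =
      mulS (delta (fclass F)) (fclass G)
      + (-1) ^+ fdeg F *: mulS (fclass F) (delta (fclass G))
}.

Definition arborescent_Koszul_Tate psi : Prop :=
  exists delta : {linear STree M -> STree M},
    is_delta psi delta /\ forall x, delta (delta x) = 0.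

(* The modules M_2, M_3, ... (that is, [resmod 1], [resmod 2], ...) and their
   differentials come from solving n problems of the first type with free
   modules of finite rank, after which the resolution is complete. *)
Definition resolution_from_problems (n : nat) : Prop :=
  [/\ free_of_finite_rank (M 0%N),
      (0 < n)%N -> exists P : first_type_problem (M 0%N) O^o,
        [/\ first_map P = aug X, free_of_finite_rank (M 1%N)
          & solves_first_type P (diff X 0%N)],
      forall k, (k.+1 < n)%N -> exists P : first_type_problem (M k.+1) (M k),
        [/\ first_map P = diff X k, free_of_finite_rank (M k.+2)
          & solves_first_type P (diff X k.+1)]
    & forall k, (n <= k)%N -> trivial_module (M k)].

(* [operation_procedure k n]: the components of psi below k being known, find
   the next n components, one at a time, as solutions of problems of the second
   type. Each problem may depend on the solutions found for the previous ones,
   and the procedure has to continue whatever solution is found. *)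
Inductive operation_procedure : nat -> nat -> Type :=
| Stop k : operation_procedure k 0
| Solve k n (P : second_type_problem (tree_ge2 M k.+2) (M k)) :
    free_of_finite_rank (tree_ge2 M k.+2) ->
    free_of_finite_rank (M k) ->
    (forall f : {linear tree_ge2 M k.+2 -> M k},
      solves_second_type P f -> operation_procedure k.+1 n) ->
    operation_procedure k n.+1.

Fixpoint outcome k n (p : operation_procedure k n) psi : Prop :=
  match p with
  | Stop _ => True
  | @Solve k _ P _ _ next =>
      exists h : solves_second_type P (psi k), outcome (next (psi k) h) psi
  end.

End KoszulTate.

(* Main.v *)
Require Import Defs.
From HB Require Import structures.
From mathcomp Require Import all_boot all_algebra.
From mathcomp Require Import boolp finmap.
From mathcomp Require Import monalg.
Import Defs.

Set Implicit Arguments.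
Unset Strict Implicit.
Unset Printing Implicit Defensive.

Import GRing.Theory.
Local Open Scope ring_scope.

(* An operation psi extends to a linear map Psi from S(Tree[M]) to M: the
   identity on leaves, psi o r on products of at least two trees, and 0 on trees
   with at least two leaves. For a product F of at least two trees,
     delta^2 (r F) = |[Psi (delta F) - d (Psi F)] + r (delta^2 F),
   so by induction delta^2 = 0 if and only if Psi is a chain map, that is,
   d (psi (r F)) = Psi (delta F) for all such F. The right-hand side involves
   only components of psi of lower degree, and it is a cycle once these satisfy
   the same condition; exactness of M then turns the next component into a
   lifting problem along the surjection d : M_(k+1) -> ker d. A finite free
   resolution of I itself provides M, and the condition is vacuous in the
   degrees where M vanishes.

   The modules of trees are free of finite rank: choose bases of the M_k and one
   tree with leaves in these bases per isomorphism class, leaving out, when 2 is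
   invertible, the trees with an automorphism of Koszul sign -1, since these
   vanish. As K is a field, 2 is either zero or invertible in O. *)

(** * Generated submodules, quotients and free modules on a set *)

Section SpanTheory.
Variable R : nzRingType.
Implicit Types V W : lmodType R.

Lemma spanP V (P : V -> Prop) v : v \in span P <-> in_span P v.
Proof. by split=> [/asboolP|h]; last exact/asboolP. Qed.

Lemma mem_span V (P : V -> Prop) v : P v -> v \in span P.
Proof.
by move=> Pv; apply/spanP; rewrite -[v]addr0 -[v]scale1r; apply: InSpanS => //;
   apply: InSpan0.
Qed.

Lemma span_sub V (P : V -> Prop) (S : submodClosed V) :
  (forall v, P v -> v \in S) -> {subset span P <= S}.
Proof.
move=> PS v /spanP; elim=> [|c x y Px _ IH]; first exact: rpred0.
by apply: rpredD => //; apply/rpredZ/PS.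
Qed.

Lemma span_ind V (P Q : V -> Prop) :
  Q 0 -> (forall c x y, P x -> Q y -> Q (c *: x + y)) ->
  forall v, v \in span P -> Q v.
Proof. by move=> Q0 QS v /spanP; elim=> // c x y Px _; apply: QS. Qed.

Lemma span_eq_lin V W (P : V -> Prop) (f g : {linear V -> W}) :
  (forall v, P v -> f v = g v) -> forall v, v \in span P -> f v = g v.
Proof.
move=> fg; apply: span_ind => [|c x y Px IH]; first by rewrite !linear0.
by rewrite !linearP fg // IH.
Qed.

Lemma spanned_val_linear V (P : V -> Prop) :
  linear (@spanned_val R V P).
Proof. by move=> a u v. Qed.
HB.instance Definition _ V (P : V -> Prop) :=
  GRing.isLinear.Build R (spanned P) V *:%R (@spanned_val R V P)
    (@spanned_val_linear V P).

Lemma spanned_valP V (P : V -> Prop) (x : spanned P) :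
  spanned_val x \in span P.
Proof. by case: x. Qed.

Lemma spanned_val_inj V (P : V -> Prop) : injective (@spanned_val R V P).
Proof. exact: val_inj. Qed.

Section Corestrict.
Variables (V W : lmodType R) (P : W -> Prop) (f : {linear V -> W}).
Hypothesis fP : forall v, f v \in span P.

Definition corestrict (v : V) : spanned P := Spanned (fP v).

Lemma corestrict_linear : linear corestrict.
Proof.
by move=> a u v; apply: spanned_val_inj; rewrite [RHS]linearP /= linearP.
Qed.
HB.instance Definition _ :=
  GRing.isLinear.Build R V (spanned P) *:%R corestrict corestrict_linear.
End Corestrict.

Lemma quot_class_linear V (P : V -> Prop) : linear (quot_class P).
Proof.
by move=> a u v; rewrite quot_classD quot_classZ.
Qed.
HB.instance Definition _ V (P : V -> Prop) :=
  GRing.isLinear.Build R V (quotmod P) *:%R (quot_class P)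
    (@quot_class_linear V P).

Lemma quot_class_scale V (P : V -> Prop) a u :
  quot_class P (a *: u) = a *: quot_class P u.
Proof. exact: linearZ. Qed.

Lemma quot_class_lin V (P : V -> Prop) a u v :
  quot_class P (a *: u + v) = a *: quot_class P u + quot_class P v.
Proof. exact: linearP. Qed.

End SpanTheory.

Section MalgLift.
Variables (R : nzRingType) (X : choiceType) (V : lmodType R) (f : X -> V).

Definition malg_lift (x : {malg R[X]}) : V := \sum_(k <- msupp x) x@_k *: f k.

Lemma malg_liftEw (d : {fset X}) x : (msupp x `<=` d)%fset ->
  malg_lift x = \sum_(k <- d) x@_k *: f k.
Proof.
move=> le; rewrite /malg_lift (big_fset_incl _ le) //= => k kd.
by move=> /mcoeff_outdom ->; rewrite scale0r.
Qed.

Lemma malg_lift_linear : linear malg_lift.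
Proof.
(* The three sums run over different supports; over the union [d] the added terms vanish. *)
move=> a u v; pose d := (msupp u `|` msupp v `|` msupp (a *: u + v))%fset.
rewrite (@malg_liftEw d (a *: u + v)) ?fsubsetUr //.
rewrite (@malg_liftEw d u) /d; last by rewrite -fsetUA fsubsetUl.
rewrite (@malg_liftEw d v) /d; last by rewrite fsetUAC fsubsetUr.
rewrite scaler_sumr -big_split /=; apply: eq_bigr => k _.
by rewrite mcoeffD mcoeffZ scalerDl scalerA.
Qed.
HB.instance Definition _ :=
  GRing.isLinear.Build R {malg R[X]} V *:%R malg_lift malg_lift_linear.

Lemma malg_liftU k : malg_lift << k >> = f k.
Proof.
by rewrite /malg_lift msuppU oner_eq0 big_seq_fset1 mcoeffUU scale1r.
Qed.

End MalgLift.

Lemma malg_ind (R : nzRingType) (X : choiceType) (P : {malg R[X]} -> Prop) :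
  P 0 -> (forall c k x, P x -> P (c *: << k >> + x)) -> forall x, P x.
Proof.
move=> P0 PS x; have -> : x = malg_lift (fun k => << k >>) x.
  rewrite [LHS]monalgE; apply: eq_bigr => k _.
  by apply/malgP => j; rewrite mcoeffZ !mcoeffU mulr_natr.
by rewrite /malg_lift; elim/big_rec: _ => // k u _; apply: PS.
Qed.

(** * The universal property of S(Tree[M]) *)

Section STreeLift.
Variables (O : comNzRingType) (M : nat -> lmodType O).
Implicit Types (F G H : forest M) (x y z : STree M).

(** A map on forests descends to a linear map on S(Tree[M]) exactly when it respects the two
    families of defining relations. *)
Record compatible (V : lmodType O) (f : forest M -> V) : Prop := Compatible {
  compatible_lin : forall c F G H,
    lin_forest c F G H -> f H = c *: f F + f G;
  compatible_swap : forall n F G, swap n F G -> f F = (-1) ^+ n *: f G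
}.

Lemma fclass_compatible : compatible (@fclass O M).
Proof.
split=> [c F G H FGH | n F G FG].
  rewrite /fclass -quot_class_lin; apply/esym/quot_classP/mem_span.
  exact: MultilinearRel FGH.
rewrite /fclass -quot_class_scale; apply/quot_classP/mem_span.
exact: SymmetryRel FG.
Qed.

Section Lift.
Variables (V : lmodType O) (f : forest M -> V).

(** Taking the proof [fc] as an argument lets the linear structure below be attached to this
    term. *)
Definition stree_lift (fc : compatible f) x : V := malg_lift f (quot_repr x).

Variable fc : compatible f.

Lemma malg_lift_compatible u : u \in span (@forest_relation O M) ->
  malg_lift f u = 0.
Proof.
move: u; apply: span_ind => [|c r y Pr IH]; first exact: linear0.
rewrite linearP /= IH addr0; case: Pr => [d F G H FGH|n F G FG];
  rewrite linearB ?linearD linearZ /= !malg_liftU.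
  by rewrite (compatible_lin fc FGH) -!scalerDr subrr scaler0.
by rewrite (compatible_swap fc FG) -scalerDr subrr scaler0.
Qed.

Lemma stree_lift_class u : stree_lift fc (quot_class _ u) = malg_lift f u.
Proof.
apply/eqP; rewrite -subr_eq0 -linearB; apply/eqP/malg_lift_compatible.
by apply/quot_classP; rewrite quot_reprK.
Qed.

Lemma stree_lift_linear : linear (stree_lift fc).
Proof.
move=> a x y; rewrite -[x]quot_reprK -[y]quot_reprK.
by rewrite -quot_class_lin !stree_lift_class linearP.
Qed.
HB.instance Definition _ :=
  GRing.isLinear.Build O (STree M) V *:%R (stree_lift fc) stree_lift_linear.

Lemma stree_liftE F : stree_lift fc (fclass F) = f F.
Proof. by rewrite /fclass stree_lift_class malg_liftU. Qed.
End Lift.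

Lemma STree_ind (P : STree M -> Prop) :
  P 0 -> (forall c F x, P x -> P (c *: fclass F + x)) -> forall x, P x.
Proof.
move=> P0 PS x; rewrite -[x]quot_reprK; move: (quot_repr x).
apply: malg_ind => [|c k u]; first by rewrite linear0.
by rewrite linearP; apply: PS.
Qed.

End STreeLift.

(** * Forests and the algebra they generate *)

Scheme lin_tree_mind := Minimality for lin_tree Sort Prop
with lin_forest_mind := Minimality for lin_forest Sort Prop.
Combined Scheme lin_ind from lin_tree_mind, lin_forest_mind.

Section Forests.
Variables (O : comNzRingType) (M : nat -> lmodType O).
Implicit Types (t u v : dtree M) (F G H : forest M).

(** [dtree] is nested through [seq]: an induction needs hypotheses on the whole list of children, so
    trees and forests are treated together. *)
Lemma dtree_forest_ind (P : dtree M -> Prop) (Q : forest M -> Prop) :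
  (forall k (a : M k), P (Leaf a)) ->
  (forall t1 t2 ts, Q [:: t1, t2 & ts] -> P (Node t1 t2 ts)) ->
  Q [::] -> (forall t F, P t -> Q F -> Q (t :: F)) ->
  (forall t, P t) /\ (forall F, Q F).
Proof.
move=> Pl Pn Q0 Qc.
have PP : forall t, P t.
  fix IH 1 => -[k a|t1 t2 ts]; first exact: Pl.
  apply: Pn; apply: (Qc _ _ (IH t1)); apply: (Qc _ _ (IH t2)).
  by elim: ts => [|t ts IHs]; [exact: Q0 | exact: (Qc _ _ (IH t) IHs)].
by split=> //; elim=> // t F; apply: Qc.
Qed.

Lemma tdeg_node t1 t2 ts : tdeg (Node t1 t2 ts) = (fdeg [:: t1, t2 & ts]).+1.
Proof. by rewrite /fdeg /= addnA. Qed.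

Lemma fdeg_cons t F : fdeg (t :: F) = (tdeg t + fdeg F)%N. Proof. by []. Qed.

Lemma fdeg_cat F G : fdeg (F ++ G) = (fdeg F + fdeg G)%N.
Proof. by rewrite /fdeg map_cat sumn_cat. Qed.

Lemma tdeg_gt0 t : (0 < tdeg t)%N. Proof. by case: t. Qed.

Lemma fdeg_eq0 F : (fdeg F == 0%N) = (F == [::]).
Proof.
by case: F => // t F; rewrite fdeg_cons addn_eq0 -leqn0 leqNgt tdeg_gt0.
Qed.

Lemma size_fdeg F : (size F <= fdeg F)%N.
Proof.
by elim: F => // t F IH; rewrite fdeg_cons /= -add1n leq_add // tdeg_gt0.
Qed.

Lemma fdeg_rem t F : t \in F -> fdeg F = (tdeg t + fdeg (rem t F))%N.
Proof. by move=> tF; rewrite /fdeg !sumnE !big_map (big_rem t). Qed.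

Lemma tdeg_le_fdeg t F : t \in F -> (tdeg t <= fdeg F)%N.
Proof. by move=> /fdeg_rem ->; apply: leq_addr. Qed.

Lemma tdeg_lt_fdeg t F : (1 < size F)%N -> t \in F -> (tdeg t < fdeg F)%N.
Proof.
move=> F1 tF; rewrite (fdeg_rem tF) -addn1 leq_add2l.
by apply: leq_trans (size_fdeg _); rewrite size_rem //; case: (size F) F1.
Qed.

Lemma lin_deg c :
  (forall t u v, lin_tree c t u v -> tdeg t = tdeg v /\ tdeg u = tdeg v) /\
  (forall F G H, lin_forest c F G H -> fdeg F = fdeg H /\ fdeg G = fdeg H).
Proof.
apply: lin_ind => //
  [? ? ? ? ? ? ? ? ? _ [e1 e2]|? ? ? ? _ [e1 e2]|? ? ? ? _ [e1 e2]].
- by rewrite !tdeg_node e1 e2.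
- by rewrite !fdeg_cons e1 e2.
- by rewrite !fdeg_cons e1 e2.
Qed.

Lemma lin_forest_size c F G H :
  lin_forest c F G H -> size F = size H /\ size G = size H.
Proof. by elim=> // ? ? ? ? _ /= [-> ->]. Qed.

Lemma swap_deg n F G : swap n F G -> fdeg F = fdeg G.
Proof.
elim=> [t u E|m t E E' _|m t1 t2 ts u1 u2 us E _ IH].
- by rewrite !fdeg_cons addnCA.
- by rewrite !fdeg_cons => ->.
- by rewrite !fdeg_cons !tdeg_node IH.
Qed.

Lemma swap_size n F G : swap n F G -> size F = size G.
Proof. by elim=> // ? ? ? ? _ /= ->. Qed.

Lemma lin_forest_catl c F G H E :
  lin_forest c F G H -> lin_forest c (E ++ F) (E ++ G) (E ++ H).
Proof. by move=> h; elim: E => //= t E; apply: LinTail. Qed.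

Lemma lin_forest_catr c F G H E :
  lin_forest c F G H -> lin_forest c (F ++ E) (G ++ E) (H ++ E).
Proof.
by elim=> [t u v D|t D D' D'' _] /=; [apply: LinHead|apply: LinTail].
Qed.

Lemma swap_catl n F G E : swap n F G -> swap n (E ++ F) (E ++ G).
Proof. by move=> h; elim: E => //= t E; apply: SwapTail. Qed.

Lemma swap_catr n F G E : swap n F G -> swap n (F ++ E) (G ++ E).
Proof.
by elim=> [t u D|m t D D' _|m t1 t2 ts u1 u2 us D h _] /=;
   [exact: SwapHead|exact: SwapTail|exact: SwapNode].
Qed.

Lemma swap_sym n F G : swap n F G -> swap n G F.
Proof.
elim=> [t u D|m t D D' _|m t1 t2 ts u1 u2 us D _ h].
- by rewrite mulnC; apply: SwapHead.
- exact: SwapTail.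
- exact: SwapNode.
Qed.

Definition is_node F : bool := if F is [:: Node _ _ _] then true else false.

Lemma is_nodeP F :
  reflect (exists t1 t2 ts, F = [:: Node t1 t2 ts]) (is_node F).
Proof.
case: F => [|[k a|t1 t2 ts] [|u F]] /=; constructor; try by case=> ? [? [?]].
by exists t1, t2, ts.
Qed.

(** Such a quantity is constant across each defining relation, so a compatible map stays compatible
    when it is set to 0 outside an invariant predicate. *)
Definition shape_invariant (T : Type) (P : forest M -> T) : Prop :=
  (forall c F G H, lin_forest c F G H -> P F = P H /\ P G = P H) /\
  (forall n F G, swap n F G -> P F = P G).

Lemma fdeg_shape : shape_invariant (@fdeg O M).
Proof. by split=> [c F G H /(proj2 (lin_deg c))|n F G /swap_deg]. Qed.

Lemma size_shape : shape_invariant (fun F => size F).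
Proof. by split=> [c F G H /lin_forest_size|n F G /swap_size]. Qed.

Lemma is_node_shape : shape_invariant is_node.
Proof.
split=> [c F G H h|n F G h].
  case: h (lin_forest_size h) => [t u v E h _|t E1 E2 E3 _ []].
    by case: E => [|? ?]; case: h.
  by case: E1 E2 E3 => [|? ?] [|? ?] [|? ?] //=; case: t.
case: h (swap_size h) => [t u E _|m t E1 E2 _|m t1 t2 ts u1 u2 us []] //=.
  by case: t; case: u.
by case: E1 E2 => [|? ?] [|? ?] //=; case: t.
Qed.

Lemma compatible_if (V : lmodType O) (f : forest M -> V) (P : pred (forest M)) :
  compatible f -> shape_invariant P ->
  compatible (fun F => if P F then f F else 0).
Proof.
move=> [fl fs] [Pl Ps]; split=> [c F G H h|n F G h].
  have [-> ->] := Pl _ _ _ _ h.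
  by case: ifP; rewrite ?(fl _ _ _ _ h) // scaler0 addr0.
by rewrite (Ps _ _ _ h); case: ifP; rewrite ?(fs _ _ _ h) ?scaler0.
Qed.

Lemma compatible_cat E (V : lmodType O) (f : forest M -> V) :
  compatible f -> compatible (fun F => f (E ++ F)).
Proof.
by move=> [fl fs]; split=> [c F G H h|n F G h];
   [apply/fl/lin_forest_catl|apply/fs/swap_catl].
Qed.

End Forests.

(* An abstract stand-in for [STree M], which keeps conversion from unfolding
   the quotient of [{malg O[forest M]}]. *)
Record forest_algebra (O : comNzRingType) (M : nat -> lmodType O) :=
  ForestAlgebra {
  forest_algebra_mod :> lmodType O;
  cls : forest M -> forest_algebra_mod;
  cls_compatible : compatible cls;
  lift : forall (V : lmodType O) (f : forest M -> V),
    compatible f -> {linear forest_algebra_mod -> V};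
  liftE : forall (V : lmodType O) (f : forest M -> V) (fc : compatible f) F,
    lift fc (cls F) = f F;
  cls_ind : forall P : forest_algebra_mod -> Prop,
    P 0 -> (forall c F x, P x -> P (c *: cls F + x)) -> forall x, P x
}.
Arguments cls {O M f} F : rename.

(** * The graded commutative product *)

Section Algebra.
Variables (O : comNzRingType) (M : nat -> lmodType O) (A : forest_algebra M).
Implicit Types (t u v : dtree M) (F G H : forest M) (x y z : A).

Local Notation cls := (@cls O M A).
Let clsL := compatible_lin (cls_compatible A).
Let clsS := compatible_swap (cls_compatible A).

Lemma eq_on_cls (V : lmodType O) (f g : {linear A -> V}) :
  (forall F, f (cls F) = g (cls F)) -> f =1 g.
Proof.
by move=> fg; apply: cls_ind => [|c F x IH]; rewrite ?linear0 // !linearP fg IH.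
Qed.

Definition shift F : {linear A -> A} :=
  lift A (compatible_cat F (cls_compatible A)).

Lemma shift_cls F G : shift F (cls G) = cls (F ++ G).
Proof. exact: liftE. Qed.

Lemma shift_lin F a x y : shift F (a *: x + y) = a *: shift F x + shift F y.
Proof. exact: linearP. Qed.

Lemma shift0 F : shift F 0 = 0. Proof. exact: linear0. Qed.

Lemma shift_compatible y : compatible (shift^~ y).
Proof.
split=> [c F G H h|n F G h]; move: y; apply: cls_ind => [|d E y IH] /=.
- by rewrite !shift0 scaler0 addr0.
- rewrite !shift_lin {}IH !shift_cls (clsL (lin_forest_catr E h)).
  by rewrite !scalerDr !scalerA [d * c]mulrC addrACA.
- by rewrite !shift0 scaler0.
- rewrite !shift_lin {}IH !shift_cls (clsS (swap_catr E h)).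
  by rewrite scalerDr !scalerA [d * _]mulrC.
Qed.

Definition fmul x y : A := lift A (shift_compatible y) x.

Lemma mul_cls F G : fmul (cls F) (cls G) = cls (F ++ G).
Proof. by rewrite /fmul liftE shift_cls. Qed.

Lemma mul_clsl F y : fmul (cls F) y = shift F y.
Proof. by rewrite /fmul liftE. Qed.

Lemma mul_linl a x y z : fmul (a *: x + y) z = a *: fmul x z + fmul y z.
Proof. by rewrite /fmul linearP. Qed.

Lemma mul_linr a x y z : fmul x (a *: y + z) = a *: fmul x y + fmul x z.
Proof.
move: x; apply: cls_ind => [|d F x IH].
  by rewrite /fmul !linear0 addr0.
rewrite !mul_linl IH !mul_clsl shift_lin !scalerDr !scalerA.
by rewrite [d * a]mulrC addrACA.
Qed.

HB.instance Definition _ x := GRing.isLinear.Build O A A *:%R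
  (fmul x) (fun a y z => mul_linr a x y z).

Definition mulr_by y x := fmul x y.
HB.instance Definition _ y := GRing.isLinear.Build O A A *:%R
  (mulr_by y) (fun a x z => mul_linl a x z y).

Lemma mul0x y : fmul 0 y = 0. Proof. exact: (linear0 (mulr_by y)). Qed.
Lemma mulx0 y : fmul y 0 = 0. Proof. exact: linear0. Qed.
Lemma mulxDl x y z : fmul (x + y) z = fmul x z + fmul y z.
Proof. exact: (linearD (mulr_by z)). Qed.
Lemma mulxDr x y z : fmul z (x + y) = fmul z x + fmul z y.
Proof. exact: linearD. Qed.
Lemma mulxZl a x z : fmul (a *: x) z = a *: fmul x z.
Proof. exact: (linearZZ (mulr_by z)). Qed.
Lemma mulxZr a x z : fmul z (a *: x) = a *: fmul z x.
Proof. exact: linearZ. Qed.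

Lemma mulxA x y z : fmul x (fmul y z) = fmul (fmul x y) z.
Proof.
move: x; apply: cls_ind => [|c F x IHx]; first by rewrite !mul0x.
rewrite !mul_linl {}IHx.
suff -> : fmul (cls F) (fmul y z) = fmul (fmul (cls F) y) z by [].
move: y; apply: cls_ind => [|d G y IHy]; first by rewrite !(mul0x, mulx0).
rewrite !(mul_linl, mul_linr) {}IHy.
suff -> : fmul (cls F) (fmul (cls G) z) =
  fmul (fmul (cls F) (cls G)) z by [].
move: z; apply: cls_ind => [|e H z IHz]; first by rewrite !mulx0.
by rewrite !mul_linr {}IHz !mul_cls catA.
Qed.

Definition fone : A := cls [::].

Lemma mul1x x : fmul fone x = x.
Proof.
move: x; apply: cls_ind => [|c F x IHx]; first by rewrite !mulx0.
by rewrite mul_linr IHx mul_cls.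
Qed.

Lemma mulx1 x : fmul x fone = x.
Proof.
move: x; apply: cls_ind => [|c F x IHx]; first by rewrite !mul0x.
by rewrite mul_linl IHx mul_cls cats0.
Qed.

Lemma cls_cons t F : cls (t :: F) = fmul (cls [:: t]) (cls F).
Proof. by rewrite mul_cls. Qed.

(** The relations only exchange neighbours: [swap1] carries one tree past a forest, and induction on
    F then carries a forest, the exponents adding up to the product of the degrees. *)
Lemma cls_cat_swap F G :
  cls (F ++ G) = (-1) ^+ (fdeg F * fdeg G) *: cls (G ++ F).
Proof.
have swap1 t E : cls (t :: E) = (-1) ^+ (tdeg t * fdeg E) *: cls (rcons E t).
  elim: E => [|u E IH]; first by rewrite muln0 expr0 scale1r.
  rewrite (clsS (SwapHead t u E)).
  rewrite cls_cons IH mulxZr mul_cls scalerA -exprD fdeg_cons mulnDr.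
  by [].
elim: F G => [|t F IH] G; first by rewrite mul0n expr0 scale1r cats0.
rewrite cat_cons cls_cons IH mulxZr mul_cls /= -cat_cons -mul_cls swap1.
by rewrite mulxZl mul_cls cat_rcons scalerA -exprD fdeg_cons mulnDl addnC.
Qed.

End Algebra.

Lemma signr_eq (R : nzRingType) m n :
  odd m = odd n -> (-1) ^+ m = (-1) ^+ n :> R.
Proof. by rewrite -signr_odd => ->; rewrite signr_odd. Qed.

(** * Grading, root maps and coordinates *)

Section Graded.
Variables (O : comNzRingType) (M : nat -> lmodType O) (A : forest_algebra M).
Implicit Types (t u v : dtree M) (F G H : forest M) (x y z : A).
Local Notation cls := (@cls O M A).

Definition homog n : {pred A} :=
  span (fun x => exists2 F, fdeg F = n & x = cls F).
HB.instance Definition _ n := GRing.SubmodClosed.on (homog n).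

Lemma homog_cls F : cls F \in homog (fdeg F).
Proof. by apply: mem_span; exists F. Qed.

Lemma homogM p q x y :
  x \in homog p -> y \in homog q -> fmul x y \in homog (p + q).
Proof.
move=> xp yq; move: x xp; apply: span_ind => [|c _ x [F Fp ->] IH].
  by rewrite mul0x rpred0.
rewrite mul_linl; apply: rpredD => //; apply: rpredZ.
move: y yq {IH}; apply: span_ind => [|d _ y [G Gp ->] IH].
  by rewrite mulx0 rpred0.
rewrite mul_linr; apply: rpredD => //; apply: rpredZ.
by rewrite mul_cls -Fp -Gp -fdeg_cat homog_cls.
Qed.

Lemma mulxC p q x y : x \in homog p -> y \in homog q ->
  fmul x y = (-1) ^+ (p * q) *: fmul y x.
Proof.
move=> xp yq; move: x xp; apply: span_ind => [|c _ x [F Fp ->] IH].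
  by rewrite mul0x mulx0 scaler0.
rewrite mul_linl mul_linr {}IH scalerDr; congr (_ + _).
rewrite scalerA mulrC -scalerA; congr (_ *: _).
move: y yq; apply: span_ind => [|d _ y [G Gp ->] IH].
  by rewrite mul0x mulx0 scaler0.
rewrite mul_linl mul_linr {}IH scalerDr; congr (_ + _).
rewrite scalerA mulrC -scalerA; congr (_ *: _).
by rewrite !mul_cls cls_cat_swap Fp Gp.
Qed.

Lemma homog_linear (V : lmodType O) (S : submodClosed V) n
    (f : {linear A -> V}) :
  (forall F, fdeg F = n -> f (cls F) \in S) ->
  forall x, x \in homog n -> f x \in S.
Proof.
move=> fS; apply: span_ind => [|c _ x [F Fn ->] IH].
  by rewrite linear0 rpred0.
by rewrite linearP; apply: rpredD => //; apply/rpredZ/fS.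
Qed.

Lemma homog_eq (V : lmodType O) n (f g : {linear A -> V}) :
  (forall F, fdeg F = n -> f (cls F) = g (cls F)) ->
  forall x, x \in homog n -> f x = g x.
Proof. by move=> fg; apply: span_eq_lin => _ [F Fn ->]; apply: fg. Qed.

Lemma proj_compatible :
  compatible (fun F => if (2 <= size F)%N then cls F else 0).
Proof.
apply: compatible_if; first exact: cls_compatible.
have [sl ss] := size_shape M.
by split=> [c F G H /sl [-> ->]|n F G /ss ->].
Qed.

Lemma root_compatible :
  compatible (fun F =>
    if F is [:: t1, t2 & ts] then cls [:: Node t1 t2 ts] else 0).
Proof.
split=> [c F G H h|n F G h].
  have [] := lin_forest_size h.
  case: F G H h => [|t1 [|t2 ts]] [|u1 [|u2 us]] [|v1 [|v2 vs]] h //= _ _;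
    rewrite ?scaler0 ?addr0 //.
  apply: (compatible_lin (cls_compatible A)).
  exact/LinHead/LinNode.
have := swap_size h.
case: F G h => [|t1 [|t2 ts]] [|u1 [|u2 us]] h //= _; rewrite ?scaler0 //.
by apply: (compatible_swap (cls_compatible A)); apply: SwapNode.
Qed.

Lemma root_inv_compatible :
  compatible (fun F =>
    if F is [:: Node t1 t2 ts] then cls [:: t1, t2 & ts] else 0).
Proof.
split=> [c F G H h|n F G h].
  case: h => [t u v E []|t E1 E2 E3 h].
  - by move=> k a b; case: E => *; rewrite scaler0 addr0.
  - move=> t1 t2 ts u1 u2 us v1 v2 vs h.
    case: E => [|? ?]; last by rewrite scaler0 addr0.
    exact: (compatible_lin (cls_compatible A)).
  - by case: h => *; case: t => *; rewrite scaler0 addr0.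
case: h => [t u E|m t E1 E2 h|m t1 t2 ts u1 u2 us [|? ?] h].
- by case: t; case: u => *; rewrite scaler0.
- by case: h => *; case: t => *; rewrite scaler0.
- exact: (compatible_swap (cls_compatible A)).
- by rewrite scaler0.
Qed.

Definition proj : {linear A -> A} := lift A proj_compatible.

Lemma proj_cls F : proj (cls F) = if (2 <= size F)%N then cls F else 0.
Proof. exact: liftE. Qed.

Definition root : {linear A -> A} := lift A root_compatible.

Lemma root_cls F : root (cls F) =
  if F is [:: t1, t2 & ts] then cls [:: Node t1 t2 ts] else 0.
Proof. exact: liftE. Qed.

Definition rootV : {linear A -> A} := lift A root_inv_compatible.

Lemma rootV_cls F : rootV (cls F) =
  if F is [:: Node t1 t2 ts] then cls [:: t1, t2 & ts] else 0.
Proof. exact: liftE. Qed.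

Lemma root_proj x : root (proj x) = root x.
Proof.
move: x; apply: (eq_on_cls (f := root \o proj)) => F /=.
by rewrite proj_cls; case: F => [|t [|u F]]; rewrite /= ?linear0 ?root_cls.
Qed.

Lemma proj_root x : proj (root x) = 0.
Proof.
move: x; apply: (eq_on_cls (f := proj \o root) (g := \0)) => F /=.
by rewrite root_cls; case: F => [|t [|u F]]; rewrite /= ?linear0 ?proj_cls.
Qed.

Lemma homog_root n x : x \in homog n -> root x \in homog n.+1.
Proof.
apply: homog_linear => F <-; rewrite root_cls.
case: F => [|t [|u F]]; rewrite ?rpred0 //.
by rewrite -tdeg_node -[tdeg _]addn0 homog_cls.
Qed.

Definition leaf k (a : M k) : A := cls [:: Leaf a].

Lemma leaf_linear k : linear (@leaf k).
Proof.
by move=> c a b; apply/(compatible_lin (cls_compatible A))/LinHead/LinLeaf.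
Qed.
HB.instance Definition _ k := GRing.isLinear.Build O (M k) A *:%R
  (@leaf k) (@leaf_linear k).

Lemma root_leaf k (a : M k) : root (leaf a) = 0. Proof. exact: root_cls. Qed.

Lemma root_root x : root (root x) = 0.
Proof. by rewrite -root_proj proj_root linear0. Qed.

Lemma homog_leaf k (a : M k) : leaf a \in homog k.+1.
Proof. by have := homog_cls [:: Leaf a]; rewrite /fdeg /= addn0. Qed.

Definition leaf_at k F : M k :=
  if F is [:: Leaf j a] then
    if @eqP _ j k is ReflectT e then ecast i (M i) e a else 0
  else 0.

Arguments leaf_at k F : simpl never.

Lemma leaf_at_leaf k (a : M k) : leaf_at k [:: Leaf a] = a.
Proof.
by rewrite /leaf_at; case: eqP => // e; rewrite (eq_irrelevance e erefl).
Qed.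

Lemma leaf_at_compatible k : compatible (leaf_at k).
Proof.
split=> [c F G H h|n F G h].
  case: h => [t u v E []|t E1 E2 E3 h].
  - move=> j a b; case: E => [|? ?]; last by rewrite scaler0 addr0.
    rewrite /leaf_at.
    by case: eqP => [e|_]; [case: _ / e|rewrite scaler0 addr0].
  - by case: E => *; rewrite scaler0 addr0.
  - by case: h => *; case: t => *; rewrite scaler0 addr0.
case: h => [t u E|m t E1 E2 h|m t1 t2 ts u1 u2 us [|? ?] h].
- by case: t; case: u => *; rewrite scaler0.
- by case: h => *; case: t => *; rewrite scaler0.
- by rewrite scaler0.
- by rewrite scaler0.
Qed.

(** A linear left inverse of [leaf], which turns equations between leaves in the algebra into
    equations in M. *)
Definition leaf_part k : {linear A -> M k} :=
  lift A (leaf_at_compatible k).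

Lemma leaf_part_cls k F : leaf_part k (cls F) = leaf_at k F.
Proof. exact: liftE. Qed.

Lemma leaf_partK k (a : M k) : leaf_part k (leaf a) = a.
Proof. by rewrite leaf_part_cls leaf_at_leaf. Qed.

Lemma leaf_part_ge2 k F : (1 < size F)%N -> leaf_part k (cls F) = 0.
Proof. by rewrite leaf_part_cls; case: F => [|[? ?|? ? ?] [|? ?]]. Qed.

Lemma leaf_part_root k x : leaf_part k (root x) = 0.
Proof.
apply: (eq_on_cls (f := leaf_part k \o root) (g := \0)) => F /=.
by rewrite root_cls; case: F => [|t [|u F]]; rewrite ?linear0 ?leaf_part_cls.
Qed.

Lemma unit_compatible :
  compatible (fun F => (if F is [::] then 1 else 0) : O^o).
Proof.
split=> [c F G H []|n F G []] *; rewrite ?scaler0 ?addr0 //.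
Qed.

(** The coordinate on S^0(Tree[M]) = O, used to read off the augmentation. *)
Definition unit_part : {linear A -> O^o} := lift A unit_compatible.

Lemma unit_part_cls F : unit_part (cls F) = if F is [::] then 1 else 0.
Proof. exact: liftE. Qed.

End Graded.
Arguments leaf_at [O M] k F : simpl never.

(** * The derivation attached to an arborescent operation *)

Section Derivation.
Variables (O : comNzRingType) (M : nat -> lmodType O) (A : forest_algebra M).
Variable aug : {linear M 0%N -> O^o}.
Variable diff : forall k, {linear M k.+1 -> M k}.
Implicit Types (t u v : dtree M) (F G H : forest M) (x y z : A).
Implicit Types op : forall k, {linear A -> M k}.
Local Notation cls := (@cls O M A).
Local Notation leaf := (@leaf O M A _).
Local Notation homog := (@homog O M A).
Let clsL := compatible_lin (cls_compatible A).
Let clsS := compatible_swap (cls_compatible A).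

Definition leaf_diff k : M k -> A :=
  match k with
  | 0 => fun a => (aug a : O) *: fone A
  | k'.+1 => fun a => leaf (diff k' a)
  end.

Lemma leaf_diff_lin k c (a b : M k) :
  leaf_diff (c *: a + b) = c *: leaf_diff a + leaf_diff b.
Proof.
case: k a b => [|k] a b /=; last by rewrite !linearP.
by rewrite linearP /= scalerDl scalerA.
Qed.

Lemma homog_leaf_diff k (a : M k) : leaf_diff a \in homog k.
Proof.
case: k a => [|k] a /=; last exact: homog_leaf.
by rewrite rpredZ // (homog_cls A [::]).
Qed.

(** Each tree is paired with its differential, so that [tree_diff] can be a structural recursion
    through the list of children. *)
Fixpoint leibniz_sum (s : seq (dtree M * A)) : A :=
  if s is (t, d) :: s' then
    fmul d (cls (map fst s'))
    + (-1) ^+ tdeg t *: fmul (cls [:: t]) (leibniz_sum s')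
  else 0.

(** The operation sends a tree of degree n to degree n - 1, which is the module of index n - 2. The
    projection p^{>=2} is left out on account of [root_proj]. *)
Fixpoint tree_diff op t : A :=
  match t with
  | Leaf k a => leaf_diff a
  | Node t1 t2 ts =>
      cls [:: t1, t2 & ts]
      - leaf (op (tdeg (Node t1 t2 ts)).-2 (cls [:: Node t1 t2 ts]))
      - root A (leibniz_sum
          [:: (t1, tree_diff op t1), (t2, tree_diff op t2)
            & map (fun t => (t, tree_diff op t)) ts])
  end.

Definition forest_diff op F : A :=
  leibniz_sum (map (fun t => (t, tree_diff op t)) F).

Lemma forest_diff_cons op t F : forest_diff op (t :: F) =
  fmul (tree_diff op t) (cls F)
  + (-1) ^+ tdeg t *: fmul (cls [:: t]) (forest_diff op F).
Proof. by rewrite /forest_diff /= -map_comp map_id_in. Qed.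

Lemma tree_diff_node op t1 t2 ts (F := [:: t1, t2 & ts]) :
  tree_diff op (Node t1 t2 ts) =
  cls F - leaf (op (fdeg F).-1 (root A (cls F))) - root A (forest_diff op F).
Proof. by rewrite /F root_cls /forest_diff /= /fdeg /= addnA. Qed.

Lemma homog_cls1 t : cls [:: t] \in homog (tdeg t).
Proof. by have := homog_cls A [:: t]; rewrite /fdeg /= addn0. Qed.

Lemma homog_diff op :
  (forall t, tree_diff op t \in homog (tdeg t).-1) /\
  (forall F, forest_diff op F \in homog (fdeg F).-1).
Proof.
apply: dtree_forest_ind => [k a|t1 t2 ts IH||t F IHt IHF].
- exact: homog_leaf_diff.
- rewrite tree_diff_node tdeg_node /=.
  have e : (fdeg [:: t1, t2 & ts]).-1.+1 = fdeg [:: t1, t2 & ts].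
    by rewrite prednK // fdeg_cons addn_gt0 tdeg_gt0.
  apply: rpredB; last by rewrite -e homog_root.
  apply: rpredB; first exact: homog_cls.
  by rewrite -[X in _ \in homog X]e homog_leaf.
- exact: rpred0.
- rewrite forest_diff_cons fdeg_cons; apply: rpredD.
    have -> : (tdeg t + fdeg F).-1 = ((tdeg t).-1 + fdeg F)%N.
      by case: (tdeg t) (tdeg_gt0 t).
    by apply: homogM => //; exact: homog_cls.
  (* For empty F the truncated predecessor gives a wrong degree, but the term itself is then
     zero. *)
  apply: rpredZ; have [/eqP|F0] := posnP (fdeg F).
    by rewrite fdeg_eq0 => /eqP ->; rewrite /forest_diff /= mulx0 rpred0.
  have -> : (tdeg t + fdeg F).-1 = (tdeg t + (fdeg F).-1)%N.
    by rewrite -{1}(prednK F0) addnS.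
  by apply: homogM => //; exact: homog_cls1.
Qed.

Lemma diff_lin op c :
  (forall t u v, lin_tree c t u v ->
     tree_diff op v = c *: tree_diff op t + tree_diff op u) /\
  (forall F G H, lin_forest c F G H ->
     forest_diff op H = c *: forest_diff op F + forest_diff op G).
Proof.
apply: lin_ind
  => [k a b|t1 t2 ts u1 u2 us v1 v2 vs h IH|t u v F h IH|t F G H h IH].
- exact: leaf_diff_lin.
- rewrite !tree_diff_node IH (clsL h).
  have [-> ->] := proj2 (lin_deg M c) _ _ _ h.
  rewrite !linearP /= !scalerDr.
  by rewrite [RHS]addrACA [X in _ = X + _]addrACA.
- have [dt du] := proj1 (lin_deg M c) _ _ _ h.
  rewrite !forest_diff_cons IH (clsL (LinHead [::] h)) !mul_linl dt du.
  by rewrite !scalerDr !scalerA [_ * c]mulrC addrACA.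
- have [dt du] := proj2 (lin_deg M c) _ _ _ h.
  rewrite !forest_diff_cons IH (clsL h) !mul_linr.
  by rewrite !scalerDr !scalerA [_ * c]mulrC addrACA.
Qed.

(** For an exchange at the head, graded commutativity moves a tree or its differential past the
    other tree and matches the Leibniz terms of both sides; the deeper cases follow from the
    recursion. *)
Lemma diff_swap op n F G : swap n F G ->
  forest_diff op F = (-1) ^+ n *: forest_diff op G.
Proof.
elim=> [t u E|m t E G' h IH|m t1 t2 ts u1 u2 us E h IH].
- have [hd _] := homog_diff op.
  rewrite !forest_diff_cons !mulxDr !mulxZr !scalerDr !scalerA !mulxA.
  rewrite [cls (u :: E)]cls_cons [cls (t :: E)]cls_cons !mulxA.
  rewrite [fmul (tree_diff op t) (cls [:: u])](mulxC (hd t) (homog_cls1 u)).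
  rewrite [fmul (cls [:: t]) (tree_diff op u)](mulxC (homog_cls1 t) (hd u)).
  rewrite [fmul (cls [:: t]) (cls [:: u])](mulxC (homog_cls1 t) (homog_cls1 u)).
  rewrite !mulxZl !scalerA -!exprD addrA [X in X + _]addrC -addrA.
  (* Only parities of exponents remain. Degrees are positive, and writing them as p + 1 and q + 1
     removes the truncated predecessors. *)
  congr (_ + (_ + _)); congr (_ *: _); apply: signr_eq;
    case: (tdeg t) (tdeg_gt0 t) => // p _;
    case: (tdeg u) (tdeg_gt0 u) => // q _;
    by rewrite /= !(oddD, oddM) /=; case: (odd p); case: (odd q).
- rewrite !forest_diff_cons IH (clsS h) mulxZr mulxZr scalerDr !scalerA.
  by rewrite [_ * (-1) ^+ m]mulrC.
- rewrite !forest_diff_cons !tree_diff_node !tdeg_node IH (clsS h) (swap_deg h).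
  rewrite (clsS (SwapNode [::] h)) !linearZ /=.
  by rewrite -!scalerDr mulxZl mulxZl scalerDr !scalerA [_ * (-1) ^+ m]mulrC.
Qed.

Lemma forest_diff_compatible op : compatible (forest_diff op).
Proof.
split=> [c F G H|n F G]; [exact: (proj2 (diff_lin op c))|exact: diff_swap].
Qed.

Definition delta op : {linear A -> A} := lift A (forest_diff_compatible op).

Lemma delta_cls op F : delta op (cls F) = forest_diff op F.
Proof. exact: liftE. Qed.

Lemma delta_lin op c x y :
  delta op (c *: x + y) = c *: delta op x + delta op y.
Proof. exact: linearP. Qed.

Lemma delta_nil op : delta op (cls [::]) = 0.
Proof. by rewrite delta_cls. Qed.

Lemma delta_tree1 op t : delta op (cls [:: t]) = tree_diff op t.
Proof.
by rewrite delta_cls forest_diff_cons -/(fone A) mulx1 [forest_diff _ _]/= mulx0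
   scaler0 addr0.
Qed.

Lemma delta_leaf op k (a : M k) : delta op (leaf a) = leaf_diff a.
Proof. by rewrite delta_tree1. Qed.

Lemma delta_cons op t F : delta op (cls (t :: F)) =
  fmul (delta op (cls [:: t])) (cls F)
  + (-1) ^+ tdeg t *: fmul (cls [:: t]) (delta op (cls F)).
Proof. by rewrite delta_tree1 !delta_cls forest_diff_cons. Qed.

(** Since [root] and [proj] both kill forests with fewer than two trees, the recursion on trees
    extends to all homogeneous elements; the degree n selects the component of [op]. *)
Lemma delta_root op n x : x \in homog n ->
  delta op (root A x) =
  proj A x - leaf (op n.-1 (root A x)) - root A (delta op (proj A x)).
Proof.
move: x; apply: span_ind => [|c _ x [F Fn ->] IH].
  by rewrite !linear0 !addr0.
rewrite !linearP /= {}IH.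
suff -> : delta op (root A (cls F)) = proj A (cls F)
    - leaf (op n.-1 (root A (cls F))) - root A (delta op (proj A (cls F))).
  by rewrite !scalerDr [LHS]addrACA [X in X + _ = _]addrACA.
rewrite root_cls proj_cls.
case: F Fn => [|t1 [|t2 ts]] Fn /=; try by rewrite !linear0 !addr0.
by rewrite delta_tree1 tree_diff_node root_cls Fn delta_cls.
Qed.

Lemma homog_delta op n x : x \in homog n -> delta op x \in homog n.-1.
Proof.
apply: homog_linear => F <-; rewrite delta_cls; exact: (proj2 (homog_diff op)).
Qed.

Lemma delta_leibniz_cls op F y :
  delta op (fmul (cls F) y) =
  fmul (delta op (cls F)) y + (-1) ^+ fdeg F *: fmul (cls F) (delta op y).
Proof.
move: y; apply: cls_ind => [|c G y IH].
  by rewrite !linear0 addr0.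
rewrite !(mul_linr, delta_lin) {}IH scalerDr addrACA scalerA.
rewrite [_ * c]mulrC -scalerA -scalerDr.
suff -> : delta op (fmul (cls F) (cls G)) = fmul (delta op (cls F)) (cls G)
    + (-1) ^+ fdeg F *: fmul (cls F) (delta op (cls G)) by [].
rewrite mul_cls; elim: F {c y} => [|t F IH] /=.
  by rewrite delta_nil mul0x add0r scale1r mul1x.
rewrite [LHS]delta_cons IH (delta_cons op t F) [cls (t :: F)]cls_cons -mul_cls.
rewrite mulxDl mulxDr mulxZl mulxZr -!mulxA scalerDr scalerA addrA.
by rewrite fdeg_cons exprD.
Qed.

Lemma delta_leibniz op p x y : x \in homog p ->
  delta op (fmul x y) =
  fmul (delta op x) y + (-1) ^+ p *: fmul x (delta op y).
Proof.
move: x; apply: span_ind => [|c _ x [F Fn ->] IH].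
  by rewrite !(mul0x, linear0) addr0.
rewrite !(mul_linl, delta_lin) {}IH delta_leibniz_cls Fn.
by rewrite !scalerDr addrACA !scalerA [_ * c]mulrC.
Qed.

(** The map Psi of the overview, with values in the module of index k. *)
Definition psi_ext op k x : M k := leaf_part A k x + op k (root A x).

Lemma psi_ext_linear op k : linear (psi_ext op k).
Proof. by move=> c x y; rewrite /psi_ext !linearP /= addrACA scalerDr. Qed.
HB.instance Definition _ op k := GRing.isLinear.Build O A (M k) *:%R
  (psi_ext op k) (psi_ext_linear op k).

(* On a tree T, [root] of [delta T] gives T back. *)
Lemma sub_proj op k x : x \in homog k.+1 ->
  x - proj A x = leaf (leaf_part A k x) + root A (delta op (x - proj A x)).
Proof.
move: x; apply: span_ind => [|c _ x [F Fn ->] IH].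
  by rewrite !(linear0, addr0).
have e : c *: cls F + x - proj A (c *: cls F + x) =
    c *: (cls F - proj A (cls F)) + (x - proj A x).
  by rewrite [proj A _]linearP /= opprD scalerBr addrACA.
rewrite e [leaf_part A k _]linearP [leaf _]linearP delta_lin.
rewrite [root A _]linearP /= addrACA -IH -scalerDr.
congr (_ *: _ + _).
rewrite proj_cls leaf_part_cls.
case: F Fn {e} => [|t [|u F]] //= Fn; last first.
  by case: t Fn => *; rewrite /leaf_at /= subrr !(linear0, addr0).
rewrite subr0; case: t Fn => [j a|t1 t2 ts] Fn.
  have {Fn} Fn : j = k by move: Fn; rewrite /fdeg /= addn0 => -[].
  rewrite delta_leaf -{}Fn leaf_at_leaf.
  case: j a => [|j] a /=; last by rewrite root_leaf addr0.
  by rewrite linearZ /= root_cls scaler0 addr0.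
rewrite delta_tree1 tree_diff_node linear0 add0r !linearB /= root_cls.
by rewrite root_leaf root_root !subr0.
Qed.

(* Applied to a generator, delta^2 measures the failure of [psi_ext op] to
   be a chain map from S(Tree[M]) to M. *)
Lemma delta_sq_root op k F : (1 < size F)%N -> fdeg F = k.+2 ->
  delta op (delta op (root A (cls F))) =
  leaf (psi_ext op k (delta op (cls F)) - diff k (op k.+1 (root A (cls F))))
  + root A (delta op (delta op (cls F))).
Proof.
move=> F1 Fn; have hF : cls F \in homog k.+2 by rewrite -Fn homog_cls.
have pF : proj A (cls F) = cls F by rewrite proj_cls F1.
rewrite (delta_root op hF) pF /=.
set y := delta op (cls F); have hy : y \in homog k.+1 := homog_delta op hF.
rewrite !linearB /= -/y (delta_root op hy) /=.
(* [sub_proj] replaces [y - proj A y]; the terms [root A (delta op (proj A y))] then cancel and the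
   leaves assemble into [psi_ext]. *)
have := sub_proj op hy; rewrite delta_leaf /= /psi_ext !linearB /= => e.
rewrite [leaf (_ + _)]linearD /= !opprK !addrA.
rewrite [LHS](ACl (1*3*2*4*5)) /= e !addrA.
by rewrite [LHS](ACl (1*5*4*2*3*6)) /= subrK.
Qed.

(** * Square zero as a chain map condition *)

Section SquareZero.
Variable op : forall k, {linear A -> M k}.
Hypothesis aug_diff0 : forall a, aug (diff 0 a) = 0.
Hypothesis diff_diff0 : forall k a, diff k (diff k.+1 a) = 0.
Let delta := delta op.

(** Here F has degree k + 2 and its root tree degree k + 3, so index k constrains component k + 1 of
    [op] in terms of components up to k. Component 0 is left free: no tree with at least two leaves
    has degree 2. *)
Definition chain_condition k : Prop := forall F, (1 < size F)%N ->
  fdeg F = k.+2 ->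
  diff k (op k.+1 (root A (cls F))) = psi_ext op k (delta (cls F)).

Lemma delta_sq_leaf k (a : M k) : delta (delta (leaf a)) = 0.
Proof.
rewrite /delta delta_leaf; case: k a => [|[|k]] a /=.
- by rewrite linearZ /= delta_nil scaler0.
- by rewrite delta_leaf /= aug_diff0 scale0r.
- by rewrite delta_leaf /= diff_diff0 linear0.
Qed.

(** After two uses of the Leibniz rule the mixed terms carry opposite signs, because the derivation
    lowers the degree of t by one. *)
Lemma delta_sq_cons t F : delta (delta (cls [:: t])) = 0 ->
  delta (delta (cls F)) = 0 -> delta (delta (cls (t :: F))) = 0.
Proof.
move=> tz Fz; rewrite /delta delta_cons linearD linearZ /= -!/delta.
rewrite (delta_leibniz op _ (homog_delta op (homog_cls1 t))).
rewrite (delta_leibniz op _ (homog_cls1 t)) -/delta tz Fz mul0x mulx0 add0r.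
rewrite scaler0 addr0 -scalerDl; case: (tdeg t) (tdeg_gt0 t) => // n _ /=.
by rewrite exprS mulN1r subrr scale0r.
Qed.

(** The bound is on the degree of each tree, not on the total degree of the forest. A forest may
    thus be treated before the condition attached to its own root tree is known. *)
Lemma delta_sq_small n : (forall k, (k.+3 <= n)%N -> chain_condition k) ->
  (forall t, (tdeg t <= n)%N -> delta (delta (cls [:: t])) = 0) /\
  (forall F, all (fun t => tdeg t <= n)%N F -> delta (delta (cls F)) = 0).
Proof.
move=> cn; apply: dtree_forest_ind => [k a _|t1 t2 ts IH|_|t F IHt IHF].
- exact: delta_sq_leaf.
- rewrite tdeg_node => dn.
  have [k Fk] : exists k, fdeg [:: t1, t2 & ts] = k.+2.
    have := size_fdeg [:: t1, t2 & ts]; case: fdeg => [|[|k]] // _.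
    by exists k.
  have -> : cls [:: Node t1 t2 ts] = root A (cls [:: t1, t2 & ts]).
    by rewrite root_cls.
  rewrite /delta (delta_sq_root op _ Fk) // cn ?subrr ?linear0 ?add0r -?Fk //.
  rewrite -/delta IH ?linear0 ?addr0 //.
  by apply/allP => t /tdeg_le_fdeg tF; apply: leq_trans tF (ltnW dn).
- by rewrite /delta delta_nil linear0.
- by case/andP=> tn Fn; apply: delta_sq_cons; [apply: IHt|apply: IHF].
Qed.

Lemma chain_conditionP :
  (forall k, chain_condition k) <-> (forall x, delta (delta x) = 0).
Proof.
split=> [c|z k F F1 Fk].
  apply: cls_ind => [|a F x IH]; first by rewrite !linear0.
  rewrite !linearP /= IH addr0.
  have [_ ->] := delta_sq_small (n := fdeg F) (fun k _ => c k).
    by rewrite scaler0.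
  by apply/allP => t; apply: tdeg_le_fdeg.
have := delta_sq_root op F1 Fk; rewrite -/delta !z linear0 addr0 => /esym e.
apply/eqP; rewrite eq_sym -subr_eq0; apply/eqP.
(* The defect of the chain condition sits in a leaf, and [leaf_part] recovers it. *)
by rewrite -(leaf_partK A (_ - _)) e linear0.
Qed.

(** The chain condition is the case of products. On a leaf the equation is the definition of the
    differential; on a tree with a root vertex the left side is 0 and the two contributions of [op]
    on the right cancel. *)
Lemma psi_ext_chain k : chain_condition k -> forall x, x \in homog k.+2 ->
  diff k (psi_ext op k.+1 x) = psi_ext op k (delta x).
Proof.
move=> ck; apply: span_ind => [|c _ x [F Fn ->] IH]; first by rewrite !linear0.
rewrite !linearP /= {}IH; suff -> : diff k (psi_ext op k.+1 (cls F)) =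
  psi_ext op k (delta (cls F)) by [].
rewrite {1}/psi_ext.
case: F Fn => [|t [|u F]] // Fn; last by rewrite leaf_part_ge2 // add0r ck.
rewrite root_cls linear0 addr0 leaf_part_cls; case: t Fn => [j a|t1 t2 ts] Fn.
  have {Fn} Fn : j = k.+1 by move: Fn; rewrite /fdeg /= addn0 => -[].
  move: a; rewrite Fn => a; rewrite leaf_at_leaf /delta delta_leaf /psi_ext.
  by rewrite leaf_partK root_leaf linear0 addr0.
have Gk : fdeg [:: t1, t2 & ts] = k.+1.
  by apply: succn_inj; rewrite -tdeg_node -Fn /fdeg /= addn0.
rewrite linear0 /delta delta_tree1 tree_diff_node /psi_ext Gk !linearB /=.
rewrite leaf_part_ge2 // leaf_partK !leaf_part_root root_leaf root_root.
by rewrite !linear0 !addr0 add0r addNr.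
Qed.

Lemma aug_psi_ext x : x \in homog 1 ->
  aug (psi_ext op 0 x) = unit_part A (delta x).
Proof.
move: x; apply: (@homog_eq _ _ _ _ _ (aug \o psi_ext op 0)
  (unit_part A \o delta)) => F Fn /=.
have F1 : (size F <= 1)%N by rewrite -Fn size_fdeg.
case: F Fn F1 => [|[j a|t1 t2 ts] [|u F]] // Fn _.
  have {Fn} Fn : j = 0%N by move: Fn; rewrite /fdeg /= addn0 => -[].
  move: a; rewrite Fn => a.
  rewrite /psi_ext root_leaf linear0 addr0 leaf_partK /delta delta_leaf /=.
  by rewrite linearZ /= unit_part_cls; exact/esym/mulr1.
(* A root vertex together with one child already has degree at least 2. *)
by move: Fn; rewrite /fdeg /= addn0 => -[]; have := tdeg_gt0 t1; case: tdeg.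
Qed.

(* The obstruction to solving the chain condition in degree k + 1 is a cycle,
   so exactness of the resolution lets one solve it. *)
Lemma psi_ext_delta_cycle k F : (1 < size F)%N -> fdeg F = k.+2 ->
  (forall j, (j < k)%N -> chain_condition j) ->
  match k return M k -> Prop with
  | 0 => fun a => aug a = 0
  | j.+1 => fun a => diff j a = 0
  end (psi_ext op k (delta (cls F))).
Proof.
move=> F1 Fk cj.
have hy : delta (cls F) \in homog k.+1.
  by have := homog_delta op (homog_cls A F); rewrite Fk.
have z : delta (delta (cls F)) = 0.
  (* F has at least two trees, so each of them has degree at most k + 1, where the conditions below
     k suffice. *)
  have [_ ->] // := delta_sq_small (n := k.+1) (fun j jk => cj j (ltnW jk)).
  by apply/allP => t tF; rewrite -ltnS -Fk tdeg_lt_fdeg.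
case: k {F F1 Fk} cj (delta (cls F)) hy z => [|j] cj y hy z.
  by rewrite aug_psi_ext // z linear0.
by rewrite psi_ext_chain ?z ?linear0 //; apply: cj.
Qed.
End SquareZero.

(** In degrees up to n the recursion only meets trees of degree at most n, hence components of index
    at most n - 2. This locality allows solving degree by degree. *)
Lemma eq_delta op op' n : (forall k x, (k.+2 <= n)%N -> op k x = op' k x) ->
  forall F, (fdeg F <= n)%N -> delta op (cls F) = delta op' (cls F).
Proof.
move=> e; suff [_ h] :
    (forall t, (tdeg t <= n)%N -> tree_diff op t = tree_diff op' t)
  /\ (forall F, (fdeg F <= n)%N -> forest_diff op F = forest_diff op' F).
  by move=> F Fn; rewrite !delta_cls h.
apply: dtree_forest_ind => [//|t1 t2 ts IH|//|t F IHt IHF].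
  rewrite tdeg_node => dn; rewrite !tree_diff_node IH 1?ltnW // e //.
  rewrite prednK //; by rewrite fdeg_cons addn_gt0 tdeg_gt0.
rewrite fdeg_cons => dn; rewrite !forest_diff_cons IHt ?IHF //.
  exact: leq_trans (leq_addl _ _) dn.
exact: leq_trans (leq_addr _ _) dn.
Qed.

(** Identifies any derivation satisfying the recursion with the constructed one, by induction on
    trees and forests. *)
Lemma delta_unique op (d : {linear A -> A}) :
  d (cls [::]) = 0 -> (forall k (a : M k), d (leaf a) = leaf_diff a) ->
  (forall t1 t2 ts (F := [:: t1, t2 & ts]), d (cls [:: Node t1 t2 ts]) =
     cls F - leaf (op (fdeg F).-1 (root A (cls F))) - root A (d (cls F))) ->
  (forall t F, d (cls (t :: F)) = fmul (d (cls [:: t])) (cls F)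
     + (-1) ^+ tdeg t *: fmul (cls [:: t]) (d (cls F))) ->
  d =1 delta op.
Proof.
move=> d0 dl dn dc; apply: eq_on_cls.
suff [] : (forall t, d (cls [:: t]) = delta op (cls [:: t]))
  /\ (forall F, d (cls F) = delta op (cls F)) by [].
apply: dtree_forest_ind => [k a|t1 t2 ts IH||t F IHt IHF].
- by rewrite dl delta_leaf.
- by rewrite dn IH delta_tree1 tree_diff_node delta_cls.
- by rewrite d0 delta_nil.
- by rewrite dc delta_cons IHt IHF.
Qed.

End Derivation.

(** * Free modules of finite rank *)

Section FreeModules.
Variable R : nzRingType.
Implicit Types V W : lmodType R.

Definition pack_linear V W (f : V -> W) (lf : linear f) : {linear V -> W} :=
  HB.pack f (GRing.isLinear.Build _ _ _ _ f lf).

Lemma linear_lincomb V W (f : V -> W) (I : finType) (c : I -> R) (v : I -> V) :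
  linear f -> f (\sum_i c i *: v i) = \sum_i c i *: f (v i).
Proof.
move=> lf; pose g := pack_linear lf.
rewrite -[f]/(g : V -> W) linear_sum; apply: eq_bigr => i _; exact: linearZ.
Qed.

Definition dual_basis V n (v : 'I_n -> V) (phi : 'I_n -> {linear V -> R^o}) :=
  (forall i j, phi i (v j) = (i == j)%:R) /\
  (forall x, x = \sum_i phi i x *: v i).

Lemma free_of_finite_rankP V : free_of_finite_rank V <->
  exists n v phi, @dual_basis V n v phi.
Proof.
split=> [[n [f [g fK gK]]]|[n [v [phi [pv vp]]]]].
  have gl : linear g.
    by move=> a x y; apply: (can_inj fK); rewrite gK linearP /= !gK.
  pose phi (i : 'I_n) (x : V) : R^o := g x 0 i.
  have pl i : linear (phi i) by move=> a x y; rewrite /phi gl !mxE.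
  exists n, (fun i => f (delta_mx 0 i)).
  exists (fun i => pack_linear (pl i)).
  split=> [i j|x] /=; first by rewrite /phi fK mxE eqxx.
  rewrite -[LHS]gK {1}[g x]row_sum_delta linear_sum; apply: eq_bigr => i _.
  by rewrite linearZ.
pose f (c : 'rV[R]_n) : V := \sum_i c 0 i *: v i.
have fl : linear f.
  move=> a x y; rewrite /f scaler_sumr -big_split; apply: eq_bigr => i _ /=.
  by rewrite !mxE scalerDl scalerA.
exists n, (pack_linear fl).
exists (fun x => \row_i phi i x) => [c|x] /=.
  apply/rowP => j; rewrite mxE /f linear_sum (bigD1 j) //= linearZ /= pv eqxx.
  rewrite big1 => [|i ij]; first by rewrite addr0; exact: mulr1.
  by rewrite linearZ /= pv eq_sym (negPf ij); exact: mulr0.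
by rewrite [RHS]vp; apply: eq_bigr => i _; rewrite mxE.
Qed.

Lemma span_family V n (v : 'I_n -> V) x :
  x \in span (fun y => exists i, y = v i) ->
  exists c : 'I_n -> R, x = \sum_i c i *: v i.
Proof.
move: x; apply: span_ind => [|a _ y [i ->] [c ->]].
  by exists (fun=> 0); rewrite big1 // => i _; rewrite scale0r.
exists (fun j => a *+ (i == j) + c j).
rewrite [RHS](eq_bigr (fun j => (a *+ (i == j)) *: v j + c j *: v j));
  last first.
  by move=> j _ /=; rewrite scalerDl.
rewrite big_split /=; congr (_ + _); rewrite (bigD1 i) //= eqxx mulr1n.
rewrite big1 ?addr0 // => j ij.
by rewrite eq_sym (negPf ij) mulr0n scale0r.
Qed.

(** The forms are given on all of V and are merely restricted, so they certify independence inside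
    the submodule; generation is all that remains. *)
Lemma free_spanned V (P : V -> Prop) n (v : 'I_n -> V)
    (phi : 'I_n -> {linear V -> R^o}) :
  (forall i, v i \in span P) -> (forall i j, phi i (v j) = (i == j)%:R) ->
  (forall x, P x -> x \in span (fun y => exists i, y = v i)) ->
  free_of_finite_rank (spanned P).
Proof.
move=> vP pv Pv; apply/free_of_finite_rankP.
exists n, (fun i => Spanned (vP i)), (fun i => phi i \o @spanned_val _ _ P).
split=> [i j|x] /=; first exact: pv.
apply: spanned_val_inj; rewrite linear_sum.
have /span_family [c e] : spanned_val x \in span (fun y => exists i, y = v i).
  by apply: (span_sub Pv); apply: spanned_valP.
rewrite {1}e; apply: eq_bigr => i _; rewrite linearZ /=; congr (_ *: _).
rewrite e linear_sum (bigD1 i) //= linearZ /= pv eqxx big1 ?addr0 => [|j ij].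
  exact/esym/mulr1.
by rewrite linearZ /= pv eq_sym (negPf ij); exact: mulr0.
Qed.

Lemma free_of_finite_rank_projective V :
  free_of_finite_rank V -> projective_module V.
Proof.
move=> /free_of_finite_rankP [n [v [phi [_ vp]]]] A B g f gs.
have /choice [a ag] : forall i, exists a, g a = f (v i) by move=> i; apply: gs.
pose h x : A := \sum_i phi i x *: a i.
have hl : linear h.
  move=> c x y; rewrite /h scaler_sumr -big_split; apply: eq_bigr => i _ /=.
  by rewrite linearP /= scalerDl scalerA.
exists (pack_linear hl) => x /=.
rewrite {2}[x]vp !linear_sum; apply: eq_bigr => i _.
by rewrite !linearZ /= ag.
Qed.

Lemma free_of_finite_rank_free V : free_of_finite_rank V -> free_module V.
Proof.
move=> /free_of_finite_rankP [n [v [phi [pv vp]]]].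
exists 'I_n, (malg_lift v).
exists (fun x => \sum_i phi i x *: << i >>) => [|x].
  apply: malg_ind => [|c k x IH].
    by rewrite big1 // => i _; rewrite !linear0 scale0r.
  rewrite linearP /= malg_liftU -[in RHS]IH.
  rewrite [LHS](eq_bigr (fun i => (c * (i == k)%:R) *: << i >> +
    phi i (malg_lift v x) *: << i >>)); last first.
    by move=> i _; rewrite linearP /= pv -scalerDl.
  rewrite big_split /= (bigD1 k) //= eqxx mulr1 big1 ?addr0 // => i ik.
  by rewrite (negPf ik) mulr0 scale0r.
rewrite linear_sum [RHS]vp; apply: eq_bigr => i _.
by rewrite linearZ /= malg_liftU.
Qed.

Lemma projective_free_or_projective V :
  free_of_finite_rank V -> free_or_projective V.
Proof. by move=> fV; right; apply: free_of_finite_rank_projective. Qed.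

End FreeModules.

(** * Freeness of the modules of trees *)

Section SignedSwaps.
Variables (O : comNzRingType) (M : nat -> lmodType O).
Implicit Types (F G H : forest M).

(* [swap_rel s F G]: a chain of exchanges of total Koszul sign (-1) ^+ s leads
   from F to G. *)
Inductive swap_rel : bool -> forest M -> forest M -> Prop :=
| SwapRefl F : swap_rel false F F
| SwapStep n s F G H : swap n F G -> swap_rel s G H ->
    swap_rel (odd n (+) s) F H.

Lemma swap_rel_trans s s' F G H :
  swap_rel s F G -> swap_rel s' G H -> swap_rel (s (+) s') F H.
Proof.
by elim=> // n r F1 F2 F3 h _ IH /IH; rewrite -addbA; apply: SwapStep.
Qed.

Lemma swap_rel1 n F G : swap n F G -> swap_rel (odd n) F G.
Proof. by move=> h; rewrite -[odd n]addbF; apply: SwapStep h (SwapRefl _). Qed.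

Lemma swap_rel_sym s F G : swap_rel s F G -> swap_rel s G F.
Proof.
elim=> [|n r F1 F2 F3 h _ IH]; first exact: SwapRefl.
by rewrite addbC; apply: swap_rel_trans IH (swap_rel1 (swap_sym h)).
Qed.

Lemma swap_rel_cls (A : forest_algebra M) s F G :
  swap_rel s F G -> cls F = (-1) ^+ s *: cls G :> A.
Proof.
elim=> [E|n r F1 F2 F3 h _ IH]; first by rewrite expr0 scale1r.
rewrite (compatible_swap (cls_compatible A) h) IH scalerA -exprD.
by congr (_ *: _); apply: signr_eq; rewrite oddD !oddb.
Qed.

(* Non-orientable forests have cls F = - cls F. When 1 = -1 this is no
   constraint, so every forest counts as orientable. *)
Definition orientable F : Prop := (1 = -1 :> O) \/ ~ swap_rel true F F.

(** On forests with basis labels, the coordinate along the class of G. For orientable G the order of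
    the tests is immaterial: chains of both signs exist only when 1 = -1. *)
Definition swap_coef G F : O^o :=
  if `[< swap_rel false F G >] then 1
  else if `[< swap_rel true F G >] then -1 else 0.

Lemma swap_coefE G s F : orientable G -> swap_rel s F G ->
  swap_coef G F = (-1) ^+ s.
Proof.
move=> oG h; rewrite /swap_coef; case: asboolP => [h0|h0].
  case: s h => // h; case: oG => [e|[]]; first by rewrite expr1 -e.
  exact: swap_rel_trans (swap_rel_sym h) h0.
by case: s h => // h; rewrite asboolT.
Qed.

Lemma swap_coef_eq0 G F : (forall s, ~ swap_rel s F G) -> swap_coef G F = 0.
Proof. by move=> h; rewrite /swap_coef !asboolF. Qed.

Lemma swap_coef_swap G n F F' : orientable G -> swap n F F' ->
  swap_coef G F = (-1) ^+ n *: swap_coef G F'.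
Proof.
move=> oG h; have [[s hs]|nh] := pselect (exists s, swap_rel s F' G).
  rewrite (swap_coefE oG hs) (swap_coefE oG (SwapStep h hs)).
  by rewrite /GRing.scale /= -exprD; apply: signr_eq; rewrite oddD !oddb.
rewrite !swap_coef_eq0 ?scaler0 // => s hs; apply: nh; first by exists s.
by exists (odd n (+) s); apply: SwapStep (swap_sym h) hs.
Qed.

End SignedSwaps.

(** * Multilinear extension from basis labels *)

Section BasisExtension.
Variables (O : comNzRingType) (M : nat -> lmodType O).
Variables (r : nat -> nat) (e : forall k, 'I_(r k) -> M k).
Variable co : forall k, 'I_(r k) -> {linear M k -> O^o}.
Arguments e {k}.
Arguments co {k}.
Hypothesis eco : forall k, dual_basis (@e k) (@co k).
Implicit Types (t u v : dtree M) (F G H : forest M).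

Fixpoint basis_tree t : bool :=
  match t with
  | Leaf k a => [exists i, e i == a]
  | Node t1 t2 ts => [&& basis_tree t1, basis_tree t2 & all basis_tree ts]
  end.

Section Extension.
Variable V : lmodType O.
Implicit Types (g : dtree M -> V) (h : forest M -> V).

(* [tree_ext t g] is the value at t of the multilinear extension of the
   restriction of g to the trees whose leaves carry basis elements. *)
Fixpoint tree_ext t g : V :=
  match t with
  | Leaf k a => \sum_i co i a *: g (Leaf (e i))
  | Node t1 t2 ts =>
      tree_ext t1 (fun b1 => tree_ext t2 (fun b2 =>
        foldr (fun t ext h => tree_ext t (fun b => ext (fun bs => h (b :: bs))))
          (fun h => h [::]) ts (fun bs => g (Node b1 b2 bs))))
  end.

(** The fold is spelled as in [tree_ext], where it stands inline for the sake of structural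
    recursion; [tree_ext_node] is then a conversion. *)
Definition basis_ext F h : V :=
  foldr (fun t ext h => tree_ext t (fun b => ext (fun bs => h (b :: bs))))
    (fun h => h [::]) F h.

Definition on_children g F : V :=
  if F is [:: t1, t2 & ts] then g (Node t1 t2 ts) else 0.

Lemma tree_ext_node t1 t2 ts g :
  tree_ext (Node t1 t2 ts) g = basis_ext [:: t1, t2 & ts] (on_children g).
Proof. by []. Qed.

Lemma basis_ext_cons t F h : basis_ext (t :: F) h =
  tree_ext t (fun b => basis_ext F (fun bs => h (b :: bs))).
Proof. by []. Qed.

(** The extension is a finite linear combination of values at basis trees of the same degree. This
    yields generation by basis trees. *)
Lemma ext_mem (S : submodClosed V) :
  (forall t g, (forall b, basis_tree b -> tdeg b = tdeg t -> g b \in S) ->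
     tree_ext t g \in S) /\
  (forall F h, (forall bs, all basis_tree bs -> fdeg bs = fdeg F ->
     size bs = size F -> h bs \in S) -> basis_ext F h \in S).
Proof.
apply: dtree_forest_ind => [k a g gS|t1 t2 ts IH g gS|h hS|t F IHt IHF h hS].
- apply: rpred_sum => i _; apply/rpredZ/gS => //=; apply/existsP; by exists i.
- rewrite tree_ext_node; apply: IH => -[|b1 [|b2 bs]] //= /and3P[B1 B2 Bs] d _.
  by apply: gS; [apply/and3P|rewrite !tdeg_node d].
- exact: hS.
- rewrite basis_ext_cons; apply: IHt => b Bb db; apply: IHF => bs Bs dbs sbs.
  by apply: hS; rewrite /= ?Bb // ?fdeg_cons ?db ?dbs ?sbs.
Qed.

Lemma ext_lin :
  (forall t c g g', tree_ext t (fun b => c *: g b + g' b) =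
     c *: tree_ext t g + tree_ext t g') /\
  (forall F c h h', basis_ext F (fun b => c *: h b + h' b) =
     c *: basis_ext F h + basis_ext F h').
Proof.
apply: dtree_forest_ind
  => [k a c g g'|t1 t2 ts IH c g g'|//|t F IHt IHF c h h'].
- rewrite /= scaler_sumr -big_split; apply: eq_bigr => i _ /=.
  by rewrite scalerDr !scalerA [c * _]mulrC.
- rewrite !tree_ext_node -IH; congr basis_ext; apply/funext => -[|? [|? ?]] //=;
  by rewrite scaler0 addr0.
- rewrite !basis_ext_cons -IHt; congr tree_ext.
  by apply/funext => b; rewrite -IHF.
Qed.

Lemma eq_ext :
  (forall t g g', (forall b, basis_tree b -> tdeg b = tdeg t -> g b = g' b) ->
     tree_ext t g = tree_ext t g') /\
  (forall F h h', (forall bs, all basis_tree bs -> fdeg bs = fdeg F ->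
     h bs = h' bs) -> basis_ext F h = basis_ext F h').
Proof.
apply: dtree_forest_ind
  => [k a g g' gS|t1 t2 ts IH g g' gS|h h' hS|t F IHt IHF h h' hS].
- by apply: eq_bigr => i _; rewrite gS //=; apply/existsP; exists i.
- rewrite !tree_ext_node; apply: IH => -[|b1 [|b2 bs]] //= /and3P[B1 B2 Bs] d.
  by apply: gS; [apply/and3P|rewrite !tdeg_node d].
- exact: hS.
- rewrite !basis_ext_cons; apply: IHt => b Bb db; apply: IHF => bs Bs dbs.
  by apply: hS; rewrite /= ?Bb // ?fdeg_cons ?db ?dbs.
Qed.

Lemma ext_basis :
  (forall t g, basis_tree t -> tree_ext t g = g t) /\
  (forall F h, all basis_tree F -> basis_ext F h = h F).
Proof.
apply: dtree_forest_ind => [k a g|t1 t2 ts IH g Bt|//|t F IHt IHF h].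
- move=> /existsP [i /eqP <-] /=; rewrite (bigD1 i) //= (eco k).1 eqxx scale1r.
  by rewrite big1 ?addr0 // => j ij; rewrite (eco k).1 (negPf ij) scale0r.
- by rewrite tree_ext_node IH.
- by case/andP=> Bt BF; rewrite basis_ext_cons IHt // IHF.
Qed.

Lemma ext_lin_forest c :
  (forall t u v, lin_tree c t u v -> forall g,
     tree_ext v g = c *: tree_ext t g + tree_ext u g) /\
  (forall F G H, lin_forest c F G H -> forall h,
     basis_ext H h = c *: basis_ext F h + basis_ext G h).
Proof.
apply: lin_ind
  => [k a b g|t1 t2 ts u1 u2 us v1 v2 vs _ IH g|t u v F _ IH h|t F G H _ IH h].
- rewrite /= scaler_sumr -big_split; apply: eq_bigr => i _ /=.
  by rewrite linearP scalerDl scalerA.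
- by rewrite !tree_ext_node IH.
- by rewrite !basis_ext_cons IH.
- rewrite !basis_ext_cons -(proj1 ext_lin); congr tree_ext; apply/funext => b.
  exact: IH.
Qed.

(** A function that is linear in each leaf label is recovered from its values on basis labels, by
    expanding one label after the other. *)
Lemma extE :
  (forall t g, (forall c t u v, lin_tree c t u v -> g v = c *: g t + g u) ->
     g t = tree_ext t g) /\
  (forall F h, (forall c F G H, lin_forest c F G H -> h H = c *: h F + h G) ->
     h F = basis_ext F h).
Proof.
apply: dtree_forest_ind => [k a g gl|t1 t2 ts IH g gl|//|t F IHt IHF h hl].
- rewrite /= {1}[a](eco k).2.
  apply: (linear_lincomb (f := fun a => g (Leaf a))) => c x y.
  exact/gl/LinLeaf.
- rewrite tree_ext_node -IH // => c F G H l; have [] := lin_forest_size l.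
  case: F G H l => [|? [|? ?]] [|? [|? ?]] [|? [|? ?]] //= l _ _;
    rewrite ?scaler0 ?addr0 //.
  exact/gl/LinNode.
- rewrite basis_ext_cons (IHt (fun t => h (t :: F))) => [|c t1 t2 t3 l];
    last first.
    exact/hl/LinHead.
  congr tree_ext; apply/funext => b; apply: IHF => c F1 F2 F3 l.
  exact/hl/LinTail.
Qed.

Lemma functional0 (X : Type) (L : (X -> V) -> V) :
  (forall c (f f' : X -> V), L (fun x => c *: f x + f' x) = c *: L f + L f') ->
  L (fun=> 0) = 0.
Proof.
(* Writing 0 as -1 *: 0 + 0 turns linearity into L 0 = - L 0 + L 0. *)
move=> Ll; have -> : (fun=> 0) = (fun x : X => -1 *: (0 : V) + 0).
  by apply/funext => x; rewrite scaler0 addr0.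
by rewrite Ll scaleN1r addNr.
Qed.

Lemma functionalZ (X : Type) (L : (X -> V) -> V) :
  (forall c (f f' : X -> V), L (fun x => c *: f x + f' x) = c *: L f + L f') ->
  forall c f, L (fun x => c *: f x) = c *: L f.
Proof.
move=> Ll c f; rewrite -[RHS]addr0 -(functional0 Ll) -Ll; congr L.
by apply/funext => x; rewrite addr0.
Qed.

(** A finite linear combination of evaluations commutes with every linear functional L. With L
    itself an extension, this interchanges the expansions of two neighbouring trees. *)
Lemma ext_exchange (X : Type) (L : (X -> V) -> V) :
  (forall c (f f' : X -> V), L (fun x => c *: f x + f' x) = c *: L f + L f') ->
  (forall t (g : dtree M -> X -> V),
     tree_ext t (fun b => L (g b)) = L (fun x => tree_ext t (g^~ x))) /\
  (forall F (h : forest M -> X -> V),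
     basis_ext F (fun b => L (h b)) = L (fun x => basis_ext F (h^~ x))).
Proof.
move=> Ll; have L0 := functional0 Ll.
apply: dtree_forest_ind => [k a g|t1 t2 ts IH g|//|t F IHt IHF h].
- rewrite /=; elim: (index_enum _) => [|i s IH].
    by rewrite big_nil -[LHS]L0; congr L; apply/funext => x; rewrite big_nil.
  rewrite big_cons IH -Ll; congr L; apply/funext => x; by rewrite big_cons.
- rewrite tree_ext_node.
  transitivity (basis_ext [:: t1, t2 & ts]
      (fun F => L (fun x => on_children (g^~ x) F))).
    congr basis_ext; apply/funext => -[|b1 [|b2 bs]] //=; exact/esym/L0.
  exact: (IH (fun F x => on_children (g^~ x) F)).
- rewrite basis_ext_cons.
  transitivity
    (tree_ext t (fun b => L (fun x => basis_ext F (fun bs => h (b :: bs) x)))).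
    by congr tree_ext; apply/funext => b; rewrite -IHF.
  exact: (IHt (fun b x => basis_ext F (fun bs => h (b :: bs) x))).
Qed.

Lemma basis_ext_swap n F G h :
  (forall m F1 F2, swap m F1 F2 -> h F1 = (-1) ^+ m *: h F2) ->
  swap n F G -> basis_ext F h = (-1) ^+ n *: basis_ext G h.
Proof.
have tl t := proj1 ext_lin t; have fl F0 := proj2 ext_lin F0.
move=> hs s.
elim: s h hs => {n F G} [t u F|n t F G s IH|n t1 t2 ts u1 u2 us F s IH] h hs.
- rewrite !basis_ext_cons -(functionalZ (tl u)).
  (* Once the two expansions are interchanged, terms compare one by one; basis trees keep the
     degrees of t and u, so the Koszul sign is the same in every term. *)
  rewrite (proj1 (ext_exchange (tl u)) t
    (fun b b' => basis_ext F (fun bs => h (b :: b' :: bs)))).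
  apply: (proj1 eq_ext) => b' _ db'; rewrite -(functionalZ (tl t)).
  apply: (proj1 eq_ext) => b _ db; rewrite -(functionalZ (fl F)).
  by congr basis_ext; apply/funext => bs; rewrite -db -db'; apply/hs/SwapHead.
- rewrite !basis_ext_cons -(functionalZ (tl t)); congr tree_ext.
  by apply/funext => b; apply: IH => m F1 F2 s'; apply/hs/SwapTail.
- rewrite !basis_ext_cons !tree_ext_node; apply: IH => m F1 F2 s'.
  have := swap_size s'.
  case: F1 F2 s' => [|? [|? ?]] [|? [|? ?]] //= s' _; rewrite ?scaler0 //.
  rewrite -(functionalZ (fl F)); congr basis_ext; apply/funext => bs.
  exact/hs/SwapNode.
Qed.

End Extension.

Definition basis_leaves n : seq (dtree M) :=
  flatten [seq [seq Leaf (e i) | i <- enum 'I_(r k)] | k <- iota 0 n].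

Definition join_roots F : option (dtree M) :=
  if F is [:: t1, t2 & ts] then Some (Node t1 t2 ts) else None.

(** A finite list containing all forests of degree at most n with basis labels. It may contain
    others, which are filtered out later; only finiteness and coverage matter. *)
Fixpoint basis_forests n : seq (forest M) :=
  if n is n'.+1 then
    [::] :: [seq t :: F |
      t <- basis_leaves n ++ pmap join_roots (basis_forests n'),
      F <- basis_forests n']
  else [:: [::]].

Lemma mem_basis_forests n F :
  all basis_tree F -> (fdeg F <= n)%N -> F \in basis_forests n.
Proof.
elim: n F => [|n IH] [|t F] //=.
  by rewrite fdeg_cons leqNgt addn_gt0 tdeg_gt0.
rewrite fdeg_cons => /andP[Bt BF] dn; rewrite inE /=; apply/allpairsP.
exists (t, F); split=> //=; last first.
  apply: IH => //; rewrite -ltnS (leq_trans _ dn) //.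
  by rewrite -add1n leq_add2r tdeg_gt0.
have {}dn : (tdeg t <= n.+1)%N by apply: leq_trans (leq_addr _ _) dn.
rewrite mem_cat; apply/orP.
case: t Bt dn => [k a /existsP [i /eqP <-]|t1 t2 ts Bt] dn.
  left; apply/flattenP; exists [seq Leaf (e i) | i <- enum 'I_(r k)].
    by apply/mapP; exists k; rewrite ?mem_iota.
  by apply/mapP; exists i; rewrite ?mem_enum.
right; rewrite mem_pmap; apply/mapP; exists [:: t1, t2 & ts] => //.
by apply: IH => //; rewrite -ltnS -tdeg_node.
Qed.

(** * Bases of the modules of trees *)

Section TreesFree.
Variable A : forest_algebra M.
Local Notation cls := (@cls O M A).
Hypothesis char2_or_half : 1 = -1 :> O \/ exists w : O, w * 2%:R = 1.

Lemma cls_not_orientable F : ~ orientable F -> cls F = 0.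
Proof.
move=> nF; have [h|[w w2]] := char2_or_half; first by case: nF; left.
have [h|h] := pselect (swap_rel true F F); last by case: nF; right.
have e2 : cls F + cls F = 0.
  by rewrite {2}(swap_rel_cls A h) expr1 scaleN1r subrr.
by rewrite -[LHS]scale1r -w2 -scalerA scaler_nat mulr2n e2 scaler0.
Qed.

(** Greedy selection: a forest is kept only if its class is not yet generated. A kept forest is then
    orientable, as its class is nonzero, and not equivalent to an earlier one, as equivalent forests
    have proportional classes. *)
Lemma select_independent (s : seq (forest M)) : exists s' : seq (forest M),
  [/\ {subset s' <= s}, uniq s', forall G, G \in s' -> orientable G,
      forall b F G, F \in s' -> G \in s' -> swap_rel b F G -> F = G
    & forall F, F \in s ->
      cls F \in span (fun y => exists2 G, G \in s' & y = cls G)].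
Proof.
elim: s => [|E s [s' [sub us os is' gs]]]; first by exists [::]; split.
have [Egen|Enew] :=
  pselect (cls E \in span (fun y => exists2 G, G \in s' & y = cls G)).
  exists s'; split=> //.
    by move=> F /sub; rewrite inE => ->; rewrite orbT.
  by move=> F; rewrite inE => /predU1P [->|/gs].
have Erel b F : F \in s' -> ~ swap_rel b E F.
  move=> Fs h; apply: Enew; rewrite (swap_rel_cls A h); apply: rpredZ.
  by apply: mem_span; exists F.
have Es : E \notin s' by apply/negP => /Erel; apply; apply: SwapRefl.
exists (E :: s'); split.
- by move=> F; rewrite !inE => /predU1P [->|/sub ->]; rewrite ?eqxx ?orbT.
- by rewrite /= Es.
- move=> G; rewrite inE => /predU1P [->|/os //].
  by apply: contrapT => /cls_not_orientable E0; apply: Enew; rewrite E0 rpred0.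
- move=> b F G; rewrite !inE => /predU1P [->|Fs] /predU1P [->|Gs] h //.
  + by case: (Erel _ _ Gs h).
  + by case: (Erel _ _ Fs (swap_rel_sym h)).
  + exact: is' h.
- move=> F; rewrite inE => /predU1P [->|/gs].
    by apply: mem_span; exists E; rewrite ?mem_head.
  apply: (span_sub (S := span _)) => _ [G Gs ->].
  by apply: mem_span; exists G; rewrite // inE Gs orbT.
Qed.

Definition node_class n (x : A) : Prop :=
  exists t1 t2 ts, tdeg (Node t1 t2 ts) = n /\ x = cls [:: Node t1 t2 ts].

(** [swap_coef] respects exchanges but not linearity in the labels; its multilinear extension
    respects both, and gives the dual form attached to G. *)
Lemma swap_form_compatible G : orientable G ->
  compatible (fun F => basis_ext F (@swap_coef O M G)).
Proof.
move=> oG; split=> [c F1 F2 F3 h|n F1 F2 h].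
  exact: (proj2 (ext_lin_forest _ c) _ _ _ h).
by apply: basis_ext_swap h => *; apply: swap_coef_swap.
Qed.

Lemma node_class_free n : free_of_finite_rank (spanned (node_class n)).
Proof.
pose s := [seq F <- basis_forests n |
  [&& is_node F, all basis_tree F & fdeg F == n]].
have [s' [sub us os is' gs]] := select_independent s.
pose G (i : 'I_(size s')) := nth [::] s' i.
have Gs i : G i \in s' by apply: mem_nth.
have GB i : [/\ is_node (G i), all basis_tree (G i) & fdeg (G i) = n].
  by have := sub _ (Gs i); rewrite mem_filter => /andP[/and3P[? ? /eqP]].
apply: (@free_spanned _ _ _ _ (fun i => cls (G i))
  (fun i => lift A (swap_form_compatible (os _ (Gs i))))).
- move=> i; have [/is_nodeP [t1 [t2 [ts e1]]] _ dn] := GB i; apply: mem_span.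
  by exists t1, t2, ts; rewrite -dn e1 /fdeg /= addn0.
- move=> i j; have [_ BG _] := GB j; rewrite liftE (proj2 (ext_basis _)) //.
  have [->|ij] := eqVneq i j.
    by rewrite (swap_coefE (os _ (Gs j)) (SwapRefl _)) expr0.
  rewrite swap_coef_eq0 // => b /(is' _ _ _ (Gs j) (Gs i)) /eqP.
  by rewrite nth_uniq // => /eqP/val_inj ji; rewrite ji eqxx in ij.
- move=> x [t1 [t2 [ts [dn ->]]]].
  (* The class of a tree is multilinear in the labels of its children, so [extE] expands it in trees
     with basis labels. *)
  pose h := on_children (fun t => cls [:: t]).
  have hl c F1 F2 F3 : lin_forest c F1 F2 F3 -> h F3 = c *: h F1 + h F2.
    by move=> l; have := compatible_lin (root_compatible A) l.
  rewrite -[cls _]/(h [:: t1, t2 & ts]) (proj2 (extE _) _ _ hl).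
  apply: (proj2 (ext_mem (span _))) => -[|b1 [|b2 bs]] // Bb db _.
  have d1 : fdeg [:: Node b1 b2 bs] = n.
    by rewrite -dn fdeg_cons addn0 !tdeg_node db.
  apply: (span_sub (S := span _)); last first.
    have BN : all basis_tree [:: Node b1 b2 bs] by rewrite all_seq1; exact: Bb.
    by apply: gs; rewrite mem_filter BN d1 eqxx mem_basis_forests ?d1.
  move=> _ [F Fs ->]; apply: mem_span.
  have Fi : (index F s' < size s')%N by rewrite index_mem.
  by exists (Ordinal Fi); rewrite /G nth_index.
Qed.

End TreesFree.

End BasisExtension.

Lemma node_class_free_of_finite_rank (O : comNzRingType) (M : nat -> lmodType O)
    (A : forest_algebra M) n :
  (1 = -1 :> O \/ exists w : O, w * 2%:R = 1) ->
  (forall k, free_of_finite_rank (M k)) ->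
  free_of_finite_rank (spanned (@node_class O M A n)).
Proof.
move=> two fM.
have b k := cid (proj1 (free_of_finite_rankP (M k)) (fM k)).
have e k := cid (projT2 (b k)).
have co k := cid (projT2 (e k)).
exact: (node_class_free (fun k => projT2 (co k)) A two n).
Qed.

Section NodePart.
Variables (O : comNzRingType) (M : nat -> lmodType O) (A : forest_algebra M).
Local Notation cls := (@cls O M A).

Lemma node_part_compatible n :
  compatible (fun F => if is_node F && (fdeg F == n) then cls F else 0).
Proof.
apply: compatible_if; first exact: cls_compatible.
have [dl ds] := fdeg_shape M; have [nl ns] := is_node_shape M.
split=> [c F G H h|m F G h].
  by have [-> ->] := dl _ _ _ _ h; have [-> ->] := nl _ _ _ _ h.
by rewrite (ds _ _ _ h) (ns _ _ _ h).
Qed.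

Lemma node_part_in n x :
  lift A (node_part_compatible n) x \in span (@node_class O M A n).
Proof.
move: x; apply: cls_ind => [|c F x IH]; first by rewrite linear0 rpred0.
rewrite linearP /= liftE; apply: rpredD => //; apply: rpredZ.
case: ifP => [/andP[/is_nodeP [t1 [t2 [ts ->]]] /eqP Fn]|_]; last exact: rpred0.
by apply: mem_span; exists t1, t2, ts; rewrite -Fn /fdeg /= addn0.
Qed.

(** A projection onto the trees of degree n with a root vertex. Composing with it extends the
    components of an operation by 0 to the whole algebra. *)
Definition node_part n : {linear A -> spanned (@node_class O M A n)} :=
  corestrict (@node_part_in n).

Lemma node_part_cls n F : spanned_val (node_part n (cls F)) =
  if is_node F && (fdeg F == n) then cls F else 0.
Proof. exact: liftE. Qed.

Lemma node_partK n (T : spanned (@node_class O M A n)) :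
  node_part n (spanned_val T) = T.
Proof.
apply: spanned_val_inj.
apply: (@span_eq_lin _ _ _ (@node_class O M A n)
  (@spanned_val _ _ _ \o node_part n) idfun) (spanned_valP T)
  => _ [t1 [t2 [ts [Tn ->]]]].
apply: etrans (node_part_cls _ _) _.
by rewrite /= /fdeg /= addn0 -Tn eqxx.
Qed.

End NodePart.

(** * Solving for the operation degree by degree *)

Section Operations.
Variables (O : comNzRingType) (I : idealr O) (X : module_resolution I).
Local Notation M := (resmod X).
Variable A : forest_algebra M.
Local Notation cls := (@cls O M A).
Local Notation node_trees k := (spanned (@node_class O M A k)).
Local Notation operation := (forall k, {linear node_trees k.+2 -> M k}).
Implicit Types (psi : operation) (F G : forest M).

Lemma aug_diff a : aug X (diff X 0 a) = 0.
Proof. by apply/exact_aug; exists a. Qed.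

Lemma diff_diff k a : diff X k (diff X k.+1 a) = 0.
Proof. by apply/exact_diff; exists a. Qed.

Definition op_of psi k : {linear A -> M k} := psi k \o node_part A k.+2.

Lemma op_ofE psi k (T : node_trees k.+2) :
  op_of psi k (spanned_val T) = psi k T.
Proof. exact: (congr1 (psi k) (node_partK (A := A) T)). Qed.

Definition Delta psi : {linear A -> A} := delta (aug X) (diff X) (op_of psi).

Lemma tdeg_ge3 t1 t2 ts : exists k, tdeg (@Node O M t1 t2 ts) = k.+3.
Proof.
rewrite tdeg_node; have := size_fdeg [:: t1, t2 & ts].
by case: fdeg => [|[|k]] // _; exists k.
Qed.

Lemma Delta_node psi k x : x \in span (@node_class O M A k.+2) ->
  Delta psi x =
  rootV A x - leaf A (op_of psi k x) - root A (Delta psi (rootV A x)).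
Proof.
move: x; apply: span_ind => [|c _ y [t1 [t2 [ts [dn ->]]]] IH].
  by rewrite !linear0 !addr0.
rewrite !linearP; set E := cls [:: Node t1 t2 ts].
suff h : Delta psi E =
    rootV A E - leaf A (op_of psi k E) - root A (Delta psi (rootV A E)).
  rewrite [X in X = _]/= h IH !scalerDr.
  by rewrite [LHS]addrACA [X in X + _ = _]addrACA.
rewrite /E rootV_cls /Delta delta_tree1 tree_diff_node delta_cls root_cls.
by have := dn; rewrite tdeg_node => -[->].
Qed.

Lemma Delta_node_val psi k (T : node_trees k.+2) (x := spanned_val T) :
  Delta psi x = - leaf A (psi k T) - root A (Delta psi (rootV A x)) + rootV A x.
Proof.
by rewrite (Delta_node psi (spanned_valP T)) op_ofE [RHS]addrC addrA.
Qed.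

Lemma Delta_unique psi (d : {linear A -> A}) :
  d (cls [::]) = 0 ->
  (forall k (a : M k), d (leaf A a) = leaf_diff A (aug X) (diff X) a) ->
  (forall k (T : node_trees k.+2), d (spanned_val T) =
     - leaf A (psi k T) - root A (d (rootV A (spanned_val T)))
     + rootV A (spanned_val T)) ->
  (forall t F, d (cls (t :: F)) = fmul (d (cls [:: t])) (cls F)
     + (-1) ^+ tdeg t *: fmul (cls [:: t]) (d (cls F))) ->
  d =1 Delta psi.
Proof.
move=> d0 dl dt dc; apply: delta_unique => // t1 t2 ts F.
have [k dk] := tdeg_ge3 t1 t2 ts.
have TP : node_class k.+3 (cls [:: Node t1 t2 ts]) by exists t1, t2, ts.
pose T : node_trees k.+3 := Spanned (mem_span TP).
have eT : root A (cls F) = spanned_val T by rewrite root_cls.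
have dF : (fdeg F).-1 = k.+1 by have := dk; rewrite tdeg_node -/F => -[->].
rewrite dF eT op_ofE; have := dt _ T.
have -> : rootV A (spanned_val T) = cls F by rewrite -eT root_cls rootV_cls.
by rewrite addrC addrA.
Qed.

Lemma rootV_root_cls F : (1 < size F)%N -> rootV A (root A (cls F)) = cls F.
Proof. by case: F => [|t1 [|t2 ts]] // _; rewrite root_cls rootV_cls. Qed.

(** The right-hand side Psi (delta F) of the chain condition, as a linear function of the tree T = r
    F. *)
Definition chain_rhs psi k (T : node_trees k.+3) : M k :=
  psi_ext (op_of psi) k (Delta psi (rootV A (spanned_val T))).

Lemma chain_rhs_linear psi k : linear (@chain_rhs psi k).
Proof. by move=> c S T; rewrite /chain_rhs !linearP. Qed.
HB.instance Definition _ psi k := GRing.isLinear.Build O (node_trees k.+3) (M k)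
  *:%R (@chain_rhs psi k) (@chain_rhs_linear psi k).

Definition solution psi k : (node_trees k.+2 -> M k) -> Prop :=
  match k return (node_trees k.+2 -> M k) -> Prop with
  | 0 => fun _ => True
  | j.+1 => fun f => forall T, diff X j (f T) = chain_rhs psi T
  end.

Definition solved psi k : Prop := solution psi (psi k).

Lemma solvedP psi k :
  chain_condition (aug X) (diff X) (op_of psi) k <-> solved psi k.+1.
Proof.
split=> [c T|h F F1 Fk].
  have := spanned_valP T.
  suff h x : x \in span (@node_class O M A k.+3) ->
      diff X k (op_of psi k.+1 x) =
      psi_ext (op_of psi) k (Delta psi (rootV A x)).
    by move/h; rewrite op_ofE.
  apply: (span_eq_lin (f := diff X k \o op_of psi k.+1)
    (g := psi_ext (op_of psi) k \o Delta psi \o rootV A)).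
  move=> _ [t1 [t2 [ts [dn ->]]]] /=; rewrite rootV_cls.
  have := c [:: t1, t2 & ts] isT; rewrite root_cls; apply.
  by apply: succn_inj; rewrite -dn tdeg_node.
have TP : root A (cls F) \in span (@node_class O M A k.+3).
  case: F F1 Fk => [|t1 [|t2 ts]] // _ Fk; rewrite root_cls; apply: mem_span.
  by exists t1, t2, ts; rewrite tdeg_node Fk.
pose T : node_trees k.+3 := Spanned TP.
have -> : op_of psi k.+1 (root A (cls F)) = psi k.+1 T by rewrite -op_ofE.
rewrite [LHS]h /chain_rhs; congr (psi_ext _ _ (Delta _ _)).
exact/rootV_root_cls.
Qed.

Lemma eq_chain_rhs psi psi' k : (forall i, (i <= k)%N -> psi i =1 psi' i) ->
  @chain_rhs psi k =1 @chain_rhs psi' k.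
Proof.
move=> e T; rewrite /chain_rhs; have := spanned_valP T.
have eop i x : (i <= k)%N -> op_of psi i x = op_of psi' i x.
  by move=> ik; apply: e.
apply: (span_eq_lin (f := psi_ext (op_of psi) k \o Delta psi \o rootV A)
  (g := psi_ext (op_of psi') k \o Delta psi' \o rootV A)).
move=> _ [t1 [t2 [ts [dn ->]]]] /=; rewrite rootV_cls /psi_ext eop //.
rewrite /Delta (@eq_delta _ _ A _ _ _ (op_of psi') k.+2) //.
by rewrite -ltnS -tdeg_node dn.
Qed.

Lemma eq_solution psi psi' k (f f' : node_trees k.+2 -> M k) :
  (forall i, (i < k)%N -> psi i =1 psi' i) -> f =1 f' ->
  solution psi f <-> solution psi' f'.
Proof.
case: k f f' => // k f f' e ef; split=> h T.
  by rewrite -ef h (eq_chain_rhs e).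
by rewrite ef h (eq_chain_rhs e).
Qed.

Lemma eq_solved psi psi' k : (forall i, (i <= k)%N -> psi i =1 psi' i) ->
  solved psi k <-> solved psi' k.
Proof. by move=> e; apply: eq_solution => [i /ltnW/e|]; last exact: e. Qed.

Lemma Delta_sq0P psi :
  (forall x, Delta psi (Delta psi x) = 0) <-> forall k, solved psi k.
Proof.
have sqP := chain_conditionP (op_of psi) aug_diff diff_diff.
split=> [/sqP h [|k] //|h]; first exact/solvedP.
by apply/sqP => k; apply/solvedP.
Qed.

Definition cycle k : M k -> Prop :=
  match k return M k -> Prop with
  | 0 => fun a => aug X a = 0
  | j.+1 => fun a => diff X j a = 0
  end.

(** Cycles already form a submodule; [span] is used to give them a module type, the target of the
    lifting problem. *)
Lemma span_cycle k a : a \in span (@cycle k) -> cycle a.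
Proof.
move: a; apply: span_ind; case: k => [|k]; rewrite /cycle ?linear0 //.
  by move=> c x y e1 e2; rewrite linearP /= e1 e2 scaler0 addr0.
by move=> c x y e1 e2; rewrite linearP /= e1 e2 scaler0 addr0.
Qed.

Lemma diff_cycle k a : diff X k a \in span (@cycle k).
Proof.
apply: mem_span; case: k a => [|k] a; [exact: aug_diff|exact: diff_diff].
Qed.

Lemma cycle_diff k a : cycle a -> exists b, diff X k b = a.
Proof. by case: k a => [|k] a h; [apply/exact_aug|apply/exact_diff]. Qed.

Lemma chain_rhs_cycle psi k : (forall j, (j <= k)%N -> solved psi j) ->
  forall T, @chain_rhs psi k T \in span (@cycle k).
Proof.
move=> h T; rewrite /chain_rhs; have := spanned_valP T.
suff e x : x \in span (@node_class O M A k.+3) ->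
   (psi_ext (op_of psi) k \o Delta psi \o rootV A) x \in span (@cycle k).
  exact: e.
move: x; apply: span_ind => [|c _ y [t1 [t2 [ts [dn ->]]]] IH].
  by rewrite linear0 rpred0.
rewrite linearP; apply: rpredD => //; apply/rpredZ/mem_span => /=.
rewrite rootV_cls.
apply: (psi_ext_delta_cycle aug_diff diff_diff) => //.
  by apply: succn_inj; rewrite -dn tdeg_node.
by move=> j jk; apply/solvedP/h.
Qed.

(** In positive index the problem lifts [chain_rhs] along the differential, which maps onto the
    cycles by exactness. *)
Lemma solution_problem psi k : (forall j, (j < k)%N -> solved psi j) ->
  free_of_finite_rank (node_trees k.+2) ->
  exists P : second_type_problem (node_trees k.+2) (M k),
    forall f, solves_second_type P f <-> solution psi f.
Proof.
move=> h /projective_free_or_projective fN.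
case: k h fN => [|k] h fN.
  (* Component 0 obeys no condition, so a problem with zero target is posed, which every map
     solves. *)
  unshelve eexists (@SecondTypeProblem _ _ _ 'rV[O]_0 \0 \0 fN _).
    by move=> y; exists 0; rewrite thinmx0 [RHS]thinmx0.
  by split=> // _ x; rewrite [LHS]thinmx0 [RHS]thinmx0.
have onto y : exists x, corestrict (@diff_cycle k) x = y.
  have /span_cycle/cycle_diff [x xy] := spanned_valP y.
  by exists x; apply: spanned_val_inj.
exists (SecondTypeProblem (corestrict (chain_rhs_cycle h)) fN onto) => f.
split=> e T; first exact: (congr1 (@spanned_val _ _ _) (e T)).
by apply: spanned_val_inj; apply: e.
Qed.

Lemma solution_exists psi k : (forall j, (j < k)%N -> solved psi j) ->
  free_of_finite_rank (node_trees k.+2) ->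
  exists f : {linear node_trees k.+2 -> M k}, solution psi f.
Proof.
move=> h fN; have [P PP] := solution_problem h fN.
have [f fP] :=
  free_of_finite_rank_projective fN (chi1 P) (chi2_surjective (s := P)).
by exists f; apply/PP.
Qed.

Definition update psi k (f : {linear node_trees k.+2 -> M k}) : operation :=
  fun j => if @eqP _ k j is ReflectT e
    then ecast i {linear node_trees i.+2 -> M i} e f else psi j.

Lemma update_eq psi k f : @update psi k f k = f.
Proof.
by rewrite /update; case: eqP => // e; rewrite (eq_irrelevance e erefl).
Qed.

Lemma update_lt psi k f j : (j < k)%N -> @update psi k f j = psi j.
Proof.
move=> jk; rewrite /update; case: eqP => // e; exfalso.
by move: jk; rewrite e ltnn.
Qed.

Lemma solved_update psi k (f : {linear node_trees k.+2 -> M k}) :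
  (forall j, (j < k)%N -> solved psi j) ->
  solution psi f -> forall j, (j < k.+1)%N -> solved (@update psi k f) j.
Proof.
move=> h fs j; rewrite ltnS leq_eqVlt => /predU1P [->|jk].
  rewrite /solved update_eq; move: fs.
  by apply: (proj1 (eq_solution _ _)) => // i ik T; rewrite update_lt.
apply: (proj1 (eq_solved _)) (h j jk) => i ij T.
by rewrite update_lt // (leq_ltn_trans ij).
Qed.

Lemma solved_exists n : (forall k, free_of_finite_rank (node_trees k)) ->
  exists psi, forall j, (j < n)%N -> solved psi j.
Proof.
move=> fN; elim: n => [|n [psi h]]; first by exists (fun=> \0).
have [f fs] := solution_exists h (fN _).
by exists (update psi f); apply: solved_update.
Qed.

End Operations.

Definition STree_algebra (O : comNzRingType) (M : nat -> lmodType O) :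
    forest_algebra M :=
  @ForestAlgebra O M (STree M) (@fclass O M) (@fclass_compatible O M)
    (fun V f fc => stree_lift fc) (fun V f fc F => stree_liftE fc F)
    (@STree_ind O M).

(** * Transfer to the concrete S(Tree[M]) *)

Section KoszulTateLink.
Variables (O : comNzRingType) (I : idealr O) (X : module_resolution I).
Local Notation M := (resmod X).
Local Notation A := (STree_algebra M).
Implicit Types psi : arborescent_operation M.

(** This and the next three identities are conversions, since [stree_lift] unfolds to
    [forest_ext]. *)
Lemma mulSE (x y : STree M) : mulS x y = fmul (A := A) x y. Proof. by []. Qed.
Lemma root_mapE (x : STree M) : root_map x = root A x. Proof. by []. Qed.
Lemma root_invE (x : STree M) : root_inv x = rootV A x. Proof. by []. Qed.
Lemma proj_ge2E (x : STree M) : proj_ge2 x = proj A x. Proof. by []. Qed.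

Lemma is_delta_unique psi (d : {linear STree M -> STree M}) :
  is_delta psi d -> d =1 Delta (A := A) psi.
Proof.
move=> [d1 dl dt dL].
have dm (F G : forest M) : d (cls (f := A) (F ++ G)) =
    fmul (A := A) (d (fclass F)) (fclass G)
    + (-1) ^+ fdeg F *: fmul (A := A) (fclass F) (d (fclass G)).
  by have := dL F G; rewrite !mulSE (mul_cls A).
apply: (Delta_unique (A := A)).
(* The Leibniz rule for 1 = 1 * 1 reads d 1 = d 1 + d 1, hence d 1 = 0. *)
- have := dm [::] [::]; rewrite expr0 scale1r (mulx1 (A := A)) (mul1x (A := A)).
  by move=> h; apply: (addrI (d (fclass [::]))); rewrite addr0 -h.
- by case=> [|k] a; [exact: d1|exact: dl].
- move=> k T; have := dt k T.
  by rewrite proj_ge2E root_mapE root_proj root_invE.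
- by move=> t F; have := dm [:: t] F; rewrite fdeg_cons addn0.
Qed.

Lemma is_delta_Delta psi : is_delta psi (Delta (A := A) psi).
Proof.
split.
- by move=> a; apply: (delta_leaf (A := A)).
- by move=> k a; apply: (delta_leaf (A := A)).
- move=> k T; rewrite proj_ge2E root_mapE root_proj root_invE.
  exact: (Delta_node_val (A := A) psi T).
- by move=> F G; rewrite !mulSE; apply: (delta_leibniz_cls (A := A)).
Qed.

(** Uniqueness of the derivation replaces the existential by [Delta], for which square zero is
    already characterized. *)
Lemma arborescent_Koszul_TateP psi :
  arborescent_Koszul_Tate psi <-> forall k, solved (A := A) psi k.
Proof.
split=> [[d [/is_delta_unique dE d2]]|/Delta_sq0P h].
  by apply/Delta_sq0P => x; rewrite -!dE; apply: d2.
by exists (Delta (A := A) psi); split; first exact: is_delta_Delta.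
Qed.

End KoszulTateLink.

(** * The adaptive sequence of lifting problems *)

Section Procedure.
Variables (O : comNzRingType) (I : idealr O) (X : module_resolution I).
Local Notation M := (resmod X).
Local Notation A := (STree_algebra M).
Implicit Types psi : arborescent_operation M.

(** Induction on the number n of components still to be found, for all k and [psi]: whichever f
    solves problem k, the procedure goes on from [psi] updated by f. The components of [psi] from k
    on are placeholders. *)
Lemma procedure_exists psi k n :
  (forall k, free_of_finite_rank (M k)) ->
  (forall k, free_of_finite_rank (tree_ge2 M k)) ->
  (forall j, (j < k)%N -> solved (A := A) psi j) ->
  exists p : operation_procedure X k n,
    forall psi', (forall j, (j < k)%N -> psi' j =1 psi j) ->
      outcome p psi' <-> forall j, (j < k + n)%N -> solved (A := A) psi' j.
Proof.
move=> fM fT; elim: n k psi => [|n IH] k psi h.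
  exists (Stop X k) => psi' e; split=> // _ j; rewrite addn0 => jk.
  apply: (proj2 (eq_solved (A := A) _)) (h j jk) => i ij.
  exact/e/(leq_ltn_trans ij).
have [P PP] := solution_problem (A := A) h (fT _).
(* A procedure is data depending on every possible solution, so [cid] turns the induction hypothesis
   into a function of f. *)
have next f : solves_second_type P f -> {p : operation_procedure X k.+1 n |
    forall psi',
      (forall j, (j < k.+1)%N -> psi' j =1 update (A := A) psi f j) ->
      outcome p psi' <-> forall j, (j < k.+1 + n)%N -> solved (A := A) psi' j}.
  move=> fP; apply: cid; apply: IH; apply: (solved_update (A := A)) => //.
  exact/PP.
exists (Solve (fT _) (fM _) (fun f fP => sval (next f fP))) => psi' e /=.
(* The outcome of psi' follows the branch of its own component k, which is where the updated
   operation agrees with it. *)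
have upd j : (j < k.+1)%N -> psi' j =1 update (A := A) psi (psi' k) j.
  rewrite ltnS leq_eqVlt => /predU1P [->|jk] T; first by rewrite update_eq.
  by rewrite update_lt // e.
have sk : solves_second_type P (psi' k) <-> solved (A := A) psi' k.
  split=> [/PP|] s.
    by apply: (proj2 (eq_solution (A := A) (k := k) e _)) s.
  by apply/PP; apply: (proj1 (eq_solution (A := A) (k := k) e _)) s.
rewrite addnS -addSn; split=> [[s]|s].
  by move/(svalP (next _ s) _ upd).
have s' := proj2 sk (s k (leq_addr _ _)).
by exists s'; apply/(svalP (next _ s') _ upd).
Qed.

End Procedure.

(** * Resolutions of finite length *)

Section Ideals.
Variables (O : comNzRingType) (I : idealr O).

Definition ideal_module : lmodType O := spanned (fun x : O^o => x \in I).

Lemma ideal_moduleP (x : O^o) : x \in span (fun x : O^o => x \in I) <-> x \in I.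
Proof.
split; last exact: mem_span.
move: x; apply: span_ind => [|c x y xI yI]; first exact: rpred0.
by apply: rpredD => //; apply: idealMr.
Qed.

Lemma ideal_module_finitely_generated :
  noetherian O -> finitely_generated ideal_module.
Proof.
move=> /(_ I) [n [f fI]].
pose g (c : 'rV[O]_n) : O^o := \sum_i c 0 i * f i.
have gl : linear g.
  move=> a x y; rewrite /g scaler_sumr -big_split; apply: eq_bigr => i _ /=.
  by rewrite !mxE mulrDl -mulrA.
have gI c : pack_linear gl c \in span (fun x : O^o => x \in I).
  by apply/ideal_moduleP/fI; exists (c 0).
exists n, (corestrict gI) => v.
have /ideal_moduleP/fI [c vc] := spanned_valP v.
exists (\row_i c i); apply: spanned_val_inj; rewrite vc.
by apply: eq_bigr => i _; rewrite mxE.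
Qed.

(** Resolving I rather than O/I makes O itself the module in degree 0. The augmentation is the
    resolution map followed by the inclusion of I in O, whose injectivity preserves exactness. *)
Lemma finite_free_resolution : syzygy_algebra O ->
  exists (X : module_resolution I) (n : nat),
    (forall k, free_of_finite_rank (resmod X k)) /\
    (forall k, (n <= k)%N -> trivial_module (resmod X k)).
Proof.
move=> [/ideal_module_finitely_generated fg /(_ _ fg)].
case=> F [e [d [e_onto exe exd fF [n trivF]]]].
have im x : x \in I <-> exists a, (@spanned_val _ _ _ \o e) a = x.
  split=> [xI|[a <-]]; last exact/ideal_moduleP/spanned_valP.
  have [a ea] := e_onto (Spanned (mem_span (V := O^o) xI)).
  by exists a; rewrite /= ea.
have ex : exact_at (d 0%N) (@spanned_val _ _ _ \o e).
  move=> b; rewrite -exe /=; split=> [eb|->]; last by rewrite linear0.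
  by apply: spanned_val_inj; rewrite eb linear0.
exists (ModuleResolution (fun k => free_of_finite_rank_free (fF k)) im ex exd).
by exists n.
Qed.

Lemma resolution_problems (X : module_resolution I) n :
  (forall k, free_of_finite_rank (resmod X k)) ->
  (forall k, (n <= k)%N -> trivial_module (resmod X k)) ->
  resolution_from_problems X n.
Proof.
move=> fX trivX.
have fp k := projective_free_or_projective (fX k).
split=> // [_|k _].
  have fO : free_of_finite_rank O^o.
    apply/free_of_finite_rankP; exists 1%N, (fun=> 1), (fun=> idfun).
    split=> [i j|x]; rewrite ?big_ord1 /= ?[i]ord1 ?[j]ord1 //.
    exact/esym/mulr1.
  exists (FirstTypeProblem (aug X) (fp _) (projective_free_or_projective fO)).
  by split=> //; split; [exact: fp|exact: exact_aug].
exists (FirstTypeProblem (diff X k) (fp _) (fp _)).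
by split=> //; split; [exact: fp|exact: exact_diff].
Qed.

End Ideals.

Lemma alg_char2_or_half (K : fieldType) (O : comAlgType K) :
  1 = -1 :> O \/ exists w : O, w * 2%:R = 1.
Proof.
have [two0|two] := eqVneq (2%:R : K) 0; [left|right].
  apply/eqP; rewrite -subr_eq0 opprK -[1]scale1r -scalerDl.
  by rewrite -[1 + 1]/(2%:R) two0 scale0r.
exists (2%:R^-1 *: 1); rewrite -scalerAl mul1r -(scaler_nat 2 (1 : O)).
by rewrite scalerA mulVf // scale1r.
Qed.

Theorem corollary5p2 (K : fieldType) (O : comAlgType K) (I : idealr O) :
  syzygy_algebra O ->
  exists (X : module_resolution I) (n m : nat)
         (p : operation_procedure X 0 m),
    [/\ resolution_from_problems X n,
        exists psi, outcome p psi
      & forall psi, outcome p psi <-> arborescent_Koszul_Tate psi].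
Proof.
move=> /(finite_free_resolution I) [X [n [fX trivX]]].
have fT k : free_of_finite_rank (tree_ge2 (resmod X) k).
  exact: (node_class_free_of_finite_rank (STree_algebra (resmod X)) k
    (alg_char2_or_half O) fX).
(* The zero operation is a harmless start, as nothing is required below index 0. Solving for
   components 0 to n suffices: the condition on component j + 1 with j at least n is an equation in
   M_j (index j), which is trivial. *)
have [//|p pP] := @procedure_exists O I X (fun=> \0) 0 n.+1 fX fT.
exists X, n, n.+1, p; split; first exact: resolution_problems.
  have [psi h] := solved_exists (A := STree_algebra (resmod X)) n.+1 fT.
  by exists psi; apply/pP.
move=> psi; rewrite pP //.
split=> [h|/arborescent_Koszul_TateP h j _]; last exact: h.
apply/arborescent_Koszul_TateP => j; have [/h //|nj] := ltnP j n.+1.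
case: j nj => // j nj T; have tr := trivX j nj.
by rewrite [LHS]tr [RHS]tr.
Qed.
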